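(* Let $\Theta\subset\mathbb{R}^d$ be compact, let $G_0=\sum_{i=1}^{k_0}p_i^0\delta_{\theta_i^0}$ be a mixing measure with exactly $k_0<\infty$ support points, all in $\Theta$, and let $X_1,\dots,X_n$ be i.i.d. from the mixture density $p_{G_0}$ (distribution $P_{G_0}$). Let $r\ge1$ and let $\omega_n=o(1)$ be a positive sequence. Let $\Pi(\cdot|X_1,\dots,X_n)$ be the posterior distribution on $\overline{\mathcal{G}}(\Theta)$ of any Bayesian procedure such that for all constants $\delta>0$, $$\Pi\big(G\in\overline{\mathcal{G}}(\Theta):W_r(G,G_0)\le\delta\omega_n\,\big|\,X_1,\dots,X_n\big)\to1\quad\text{in }P_{G_0}\text{-probability as }n\to\infty.$$ Let $G$ be a sample from $\Pi(\cdot|X_1,\dots,X_n)$, and let $\widetilde G$ and $\tilde k$ be the outcome of the Merge-Truncate-Merge algorithm applied to $G$ with rate $\omega_n$, order $r$, and an arbitrary constant $c>0$. Then, as $n\to\infty$: (a) $\Pi(\tilde k=k_0\mid X_1,\dots,X_n)\to1$ in $P_{G_0}$-probability. (b) For all $\delta>0$, $\Pi\big(G\in\overline{\mathcal{G}}(\Theta):W_r(\widetilde G,G_0)\le\delta\omega_n\,\big|\,X_1,\dots,X_n\big)\to1$ in $P_{G_0}$-probability. (Here the posterior probabilities are taken jointly over $G$ and the internal randomization of the algorithm.)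
   Context: $p_G(x)=\int f(x|\theta)\,dG(\theta)$ for a given family of probability densities $f(\cdot|\theta)$, $\theta\in\Theta$. $\overline{\mathcal{G}}(\Theta)$ is the set of all discrete probability measures on $\Theta$ (finite or countably infinite support). $W_r$ is the $r$-th order Wasserstein distance with respect to the Euclidean norm. Merge-Truncate-Merge algorithm. Input: $G=\sum_i p_i\delta_{\theta_i}\in\overline{\mathcal{G}}(\Theta)$, $\omega_n>0$, $r\ge1$, $c>0$. Stage 1 (merge). 1. Reorder the atoms $\theta_1,\theta_2,\dots$ by simple random sampling without replacement with corresponding weights $p_1,p_2,\dots$ (successive draws are made among the not yet drawn atoms with probability proportional to their weights). Let $\tau_1,\tau_2,\dots$ be the new indices (in the drawn order) and set $\mathcal{E}=\{\tau_j\}_j$. 2. Sequentially, in the new order, for each index $\tau_j\in\mathcal{E}$: if there exists an earlier index $\tau_i$ still in $\mathcal{E}$ with $\|\theta_{\tau_i}-\theta_{\tau_j}\|\le\omega_n$, then update $p_{\tau_i}:=p_{\tau_i}+p_{\tau_j}$ and remove $\tau_j$ from $\mathcal{E}$. 3. Let $G'=\sum_{j:\tau_j\in\mathcal{E}}p_{\tau_j}\delta_{\theta_{\tau_j}}$, rewritten as $G'=\sum_{i=1}^k q_i\delta_{\phi_i}$ with $q_1\ge q_2\ge\cdots$. Stage 2 (truncate-merge). 4. Set $\mathcal{A}=\{i:q_i>(c\omega_n)^r\}$ and $\mathcal{N}=\{i:q_i\le(c\omega_n)^r\}$. 5. For each index $i\in\mathcal{A}$, if there is $j\in\mathcal{A}$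 with $j<i$ and $q_i\|\phi_i-\phi_j\|^r\le(c\omega_n)^r$, then remove $i$ from $\mathcal{A}$ and add it to $\mathcal{N}$. 6. For each $i\in\mathcal{N}$, find the atom $\phi_j$, $j\in\mathcal{A}$, nearest to $\phi_i$, and update $q_j:=q_j+q_i$. 7. Output $\widetilde G=\sum_{j\in\mathcal{A}}q_j\delta_{\phi_j}$ and $\tilde k=|\mathcal{A}|$. *)

(* Defs.v *)
From HB Require Import structures.
From mathcomp Require Import all_boot all_order all_algebra.
From mathcomp Require Import all_classical all_reals all_analysis.

Set Implicit Arguments.
Unset Strict Implicit.
Unset Printing Implicit Defensive.

Import Order.TTheory GRing.Theory Num.Theory.
Import numFieldTopology.Exports.

Local Open Scope classical_set_scope.
Local Open Scope ring_scope.

(* The norm that the library puts on matrices is the sup norm; the topology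
   (hence compactness and the Borel sets) is the same. *)
Definition enorm (R : realType) (d : nat) (x : 'rV[R]_d) : R :=
  Num.sqrt (\sum_(i < d) x 0 i ^+ 2).

Definition borel (R : realType) (d : nat) : set (set 'rV[R]_d) :=
  <<s [set U | open U] >>.

(* A discrete probability measure [\sum_i p_i \delta_(theta_i)] on R^d is given
   by its mass function [x |-> G {x}]; summability makes the support
   [[set x | 0 < G x]] finite or countably infinite. *)
Record dprob (R : realType) (d : nat) := DProb {
  mass :> 'rV[R]_d -> R ;
  mass_ge0 : forall x, 0 <= mass x ;
  mass_sum1 : (\esum_(x in setT) (mass x)%:E = 1)%E }.

(* \overline{G}(Theta) *)
Definition gbar (R : realType) (d : nat) (Theta : set 'rV[R]_d) :
  set (dprob R d) := [set G | forall x, ~ Theta x -> G x = 0].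

Section dprob_measurable.
Variables (R : realType) (d : nat).

Let m0 (x : 'rV[R]_d) : R := (x == 0)%:R.

Let m0_ge0 x : 0 <= m0 x. Proof. exact: ler0n. Qed.

Let m0_sum1 : (\esum_(x in setT) (m0 x)%:E = 1)%E.
Proof.
rewrite -[setT]setIT (esumID [set 0 : 'rV[R]_d]); last first.
  by move=> x _; rewrite lee_fin.
rewrite !setTI esum_set1 /m0 ?eqxx ?lee_fin// esum1 ?adde0//.
by move=> x /= /eqP/negbTE ->.
Qed.

HB.instance Definition _ := gen_eqMixin (dprob R d).
HB.instance Definition _ := gen_choiceMixin (dprob R d).
HB.instance Definition _ := isPointed.Build (dprob R d) (DProb m0_ge0 m0_sum1).

(* The evaluations [G |-> G(B)], [B] Borel, generate the sigma-algebra, as in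
   the library's [pprobability]; on [gbar Theta], [Theta] compact, it is the
   Borel sigma-algebra of the weak topology, i.e. of [W_r]. *)
Definition dprob_gen : set (set (dprob R d)) :=
  [set A | exists B (a : R), @borel R d B /\
     A = [set G | (\esum_(x in B) (mass G x)%:E < a%:E)%E]].

HB.instance Definition _ := @isMeasurable.Build (sigma_display dprob_gen)
  (dprob R d) <<s dprob_gen >> (@sigma_algebra0 _ setT dprob_gen)
  (@sigma_algebraC _ dprob_gen) (@sigma_algebra_bigcup _ setT dprob_gen).

End dprob_measurable.

(* Wasserstein distance of order r between mass functions. A coupling of two
   discrete measures is itself discrete. If p and q have different total
   masses there is no coupling and the distance is +oo. *)
Definition coupling (R : realType) (d : nat) (p q : 'rV[R]_d -> R) :
    set ('rV[R]_d * 'rV[R]_d -> R) :=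
  [set g | [/\ (forall z, 0 <= g z),
     (forall x, (\esum_(y in setT) (g (x, y))%:E = (p x)%:E)%E) &
     (forall y, (\esum_(x in setT) (g (x, y))%:E = (q y)%:E)%E)]].

Definition wass (R : realType) (d : nat) (r : R) (p q : 'rV[R]_d -> R) : \bar R :=
  (poweR (ereal_inf [set \esum_(z in setT)
     (g z * powR (enorm (z.1 - z.2)) r)%:E | g in coupling p q]) r^-1)%E.

Definition mixture_density (R : realType) (d : nat) (X : Type)
    (f : X -> 'rV[R]_d -> R) (G : dprob R d) (x : X) : \bar R :=
  (\esum_(theta in setT) (G theta * f x theta)%:E)%E.

Definition iid_from_density (R : realType) (dW dX : measure_display)
    (W : measurableType dW) (P : probability W R) (X : measurableType dX)
    (mu : {measure set X -> \bar R}) (p : X -> \bar R)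
    (Xs : nat -> {mfun W >-> X}) : Prop :=
  (forall i A, measurable A -> P (Xs i @^-1` A) = \int[mu]_(x in A) p x)%E /\
  (forall n (A : 'I_n -> set X), (forall i, measurable (A i)) ->
     P (\bigcap_(i in [set: 'I_n]) (Xs i @^-1` A i)) =
     \prod_(i < n) P (Xs i @^-1` A i))%E.

(* Inner probability: it is [P A] for every measurable [A] (next lemma) and
   lets the events of the theorem be written without carrying measurability
   proofs for W_r balls and for the output of the algorithm. *)
Definition inner_prob (R : realType) (dT : measure_display)
    (T : measurableType dT) (P : set T -> \bar R) (A : set T) : \bar R :=
  (1 - mu_ext P (~` A))%E.

Lemma inner_probE (R : realType) (dT : measure_display)
    (T : measurableType dT) (P : probability T R) (A : set T) :
  measurable A -> inner_prob P A = P A.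
Proof.
move=> mA; rewrite /inner_prob measurable_mu_extE; last exact: measurableC.
by rewrite -probability_setC ?setCK//; exact: measurableC.
Qed.

(* Convergence to 1 in (outer) P-probability. *)
Definition cvg1_in_prob (R : realType) (dW : measure_display)
    (W : measurableType dW) (P : probability W R) (Y : nat -> W -> \bar R) :=
  forall e : R, 0 < e ->
    mu_ext P [set w | (e%:E < `|Y n w - 1|)%E] @[n --> \oo] --> 0%E.

(* A Bayesian procedure on samples of size n whose parameter s determines a
   mixing measure [bp_mixing s] in [gbar Theta]. Prior and sampling model are
   arbitrary: s may be the mixing measure itself with [bp_model s] the n-fold
   product of its mixture, or contain hyperparameters. [bp_post] is the
   posterior of the mixing measure: a version of its conditional law given the
   sample under [bp_prior] and [bp_model]. *)
Record bayes_procedure (R : realType) (d : nat) (Theta : set 'rV[R]_d)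
    (dX : measure_display) (X : measurableType dX) (n : nat) := BayesProcedure {
  bp_disp : measure_display ;
  bp_param : measurableType bp_disp ;
  bp_prior : probability bp_param R ;
  bp_model : R.-pker bp_param ~> (n.-tuple X) ;
  bp_mixing : bp_param -> dprob R d ;
  bp_mixing_meas : measurable_fun setT bp_mixing ;
  bp_mixing_in : forall s, gbar Theta (bp_mixing s) ;
  bp_post : R.-pker (n.-tuple X) ~> (dprob R d) ;
  bp_post_in : forall x, bp_post x (gbar Theta) = 1%E ;
  bp_bayes : forall (A : set (n.-tuple X)) (B : set (dprob R d)),
    measurable A -> measurable B ->
    (\int[bp_prior]_(s in bp_mixing @^-1` B) bp_model s A =
     \int[bp_prior]_s \int[bp_model s]_(x in A) bp_post x B)%E }.

(* Successive sampling of the atoms of G without replacement. A drawn order is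
   a sequence [nat -> option 'rV[R]_d]; [None] means that no mass is left.
   [draw_prob G h o] is the probability that the next draw is [o] when the
   atoms of the list [h] have been drawn. *)
Definition draw_prob (R : realType) (d : nat) (G : dprob R d)
    (h : seq 'rV[R]_d) (o : option 'rV[R]_d) : R :=
  let left := 1 - \sum_(b <- h) G b in
  match o with
  | Some a => if a \in h then 0 else G a / left
  | None => (left == 0)%:R
  end.

Fixpoint draws_prob (R : realType) (d : nat) (G : dprob R d)
    (h : seq 'rV[R]_d) (s : seq (option 'rV[R]_d)) : R :=
  match s with
  | [::] => 1
  | o :: s' => draw_prob G h o *
      draws_prob G (if o is Some a then rcons h a else h) s'
  end.

(* The internal randomization of the algorithm: a seed u of law nu, from which
   the atoms of any G are put in a random order [order G u] whose law is the
   law of sampling without replacement. *)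
Definition samples_without_replacement (R : realType) (d : nat)
    (dE : measure_display) (E : measurableType dE) (nu : probability E R)
    (order : dprob R d -> E -> nat -> option 'rV[R]_d) : Prop :=
  (forall j (B : set 'rV[R]_d), borel B ->
     measurable [set z : dprob R d * E |
       exists2 a, B a & order z.1 z.2 j = Some a]) /\
  (forall (G : dprob R d) (s : seq (option 'rV[R]_d)),
     nu [set u | forall j, (j < size s)%N -> order G u j = nth None s j] =
     (draws_prob G [::] s)%:E).

Section merge_truncate_merge.
Variables (R : realType) (d : nat).
Local Notation T := 'rV[R]_d.
Local Notation wlist := (seq (T * R)).

(* Stage 1. The state lists the atoms kept so far, in drawn order, with their
   current weights. A new atom a within distance w of a kept atom is merged
   into the earliest such atom; otherwise [find] returns the size of the state
   and [set_nth] appends a. *)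
Definition merge_step (p : T -> R) (w : R) (s : wlist) (o : option T) : wlist :=
  if o is Some a then
    let i := find (fun b => enorm (b.1 - a) <= w) s in
    let b := nth (a, 0) s i in
    set_nth (a, 0) s i (b.1, b.2 + p a)
  else s.

Definition merge_run (p : T -> R) (w : R) (t : nat -> option T) (m : nat) :
  wlist := foldl (merge_step p w) [::] (mkseq t m).

(* With infinitely many atoms, all in a compact set, the list of kept atoms is
   eventually constant and the weights converge. *)
Definition merged (p : T -> R) (w : R) (t : nat -> option T) : wlist :=
  xget [::] [set l : wlist |
    (\forall m \near \oo, map fst (merge_run p w t m) = map fst l) /\
    (forall i, (i < size l)%N ->
       (nth (0, 0) (merge_run p w t m) i).2 @[m --> \oo]
         --> (nth (0, 0) l i).2)].

Definition sorted_merged p w t : wlist :=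
  sort (fun x y => y.2 <= x.2) (merged p w t).

(* Stage 2, with threshold thr = (c w)^r. The indices of A are examined in
   increasing order and A is updated on the fly, so that "j in A with j < i"
   refers to the earlier indices not removed yet. *)
Definition truncated (r thr : R) (L : wlist) : wlist :=
  foldl (fun A x =>
      if has (fun y => x.2 * powR (enorm (x.1 - y.1)) r <= thr) A
      then A else rcons A x)
    [::] [seq x <- L | thr < x.2].

(* Ties are resolved in favour of the smallest index. *)
Definition nearest (A : wlist) (x : T) : T * R :=
  nth (x, 0) A (find (fun y =>
    all (fun y' => enorm (x - y.1) <= enorm (x - y'.1)) A) A).

Definition final_merge (A N : wlist) : wlist :=
  [seq (y.1, y.2 + \sum_(x <- N | nearest A x.1 == y) x.2) | y <- A].

Definition mtm (r c w : R) (p : T -> R) (t : nat -> option T) : wlist :=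
  let L := sorted_merged p w t in
  let A := truncated r (powR (c * w) r) L in
  final_merge A [seq x <- L | x \notin A].

Definition list_mass (L : wlist) (x : T) : R := \sum_(y <- L | y.1 == x) y.2.

End merge_truncate_merge.

(* Main.v *)
(** Suppose [W_r(G, G0) <= s w] with [s] small.  Up to a small multiple of
    [s^r], all the mass of [G] lies within [eta w] of the atoms of [G0], and
    each of these neighbourhoods keeps nearly the mass of its atom.  When atoms
    are drawn without replacement, a neighbourhood of mass [g] is hit before
    the stray set of mass [b] except with probability at most [b / g].  If all
    neighbourhoods are hit first, the first atom drawn in each of them survives
    stage 1 and absorbs the whole neighbourhood, so every other surviving atom
    has absorbed stray mass only.  The transport cost of a stray atom bounds its
    weight times the [r]-th power of its distance to the heavy atoms, so stage 2
    discards exactly the stray atoms, which proves (a).  The algorithm thus acts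
    on [G] as a map which increases the distance to the atoms of [G0] by at most
    a constant factor outside the neighbourhoods; pushing an almost optimal
    coupling along this map proves (b). *)

(* Neither the Wasserstein balls nor the output events are shown to be measurable, so the failure of
   the conclusion is bounded in outer measure only. It is covered by two pieces: the pairs (measure,
   seed) whose measure is far from [G0], left to the hypothesis on the posterior, and a set [Z] of
   bad pairs. At each fixed measure the section of [Z] is small, with a bound that does not depend
   on the measure. Integrating these sections requires [Z] to be measurable in the product, which is
   why the drawn atoms are studied jointly in the measure and the seed. Outside both pieces the
   argument is deterministic. As the support may be infinite, probabilities of draws are never
   summed over all histories. Inequalities are instead carried back one draw at a time, using
   finitely many outcomes that have almost all of the conditional probability. *)
Require Import Defs.
From HB Require Import structures.
From mathcomp Require Import all_boot all_order all_algebra.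
From mathcomp Require Import all_classical all_reals all_analysis.
From mathcomp Require Import ring lra.

Set Implicit Arguments.
Unset Strict Implicit.
Unset Printing Implicit Defensive.

Import Order.TTheory GRing.Theory Num.Theory.
Import numFieldTopology.Exports.

Local Open Scope classical_set_scope.
Local Open Scope ring_scope.

(** * The Euclidean norm *)

Section euclidean_norm.
Variables (R : realType) (d : nat).
Local Notation T := 'rV[R]_d.
Implicit Types (x y z a : T) (rho : R).

Lemma enorm_ge0 x : 0 <= enorm x.
Proof. exact: sqrtr_ge0. Qed.

Lemma sqr_enorm x : enorm x ^+ 2 = \sum_(i < d) x 0 i ^+ 2.
Proof. by rewrite sqr_sqrtr// sumr_ge0// => i _; exact: sqr_ge0. Qed.

Lemma enormN x : enorm (- x) = enorm x.
Proof.
by rewrite /enorm; congr Num.sqrt; apply: eq_bigr => i _; rewrite mxE sqrrN.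
Qed.

Lemma enorm0 : enorm (0 : T) = 0.
Proof. by rewrite /enorm big1 ?sqrtr0// => i _; rewrite mxE expr0n. Qed.

Lemma enormB x y : enorm (x - y) = enorm (y - x).
Proof. by rewrite -enormN opprB. Qed.

Lemma le_coord_enorm x i : `|x 0 i| <= enorm x.
Proof.
rewrite -(ler_pXn2r (ltn0Sn 1)) ?nnegrE ?enorm_ge0// sqr_enorm real_normK ?num_real//.
by rewrite (bigD1 i)//= lerDl sumr_ge0// => j _; exact: sqr_ge0.
Qed.

Lemma enorm_le_coord x rho : (forall i, `|x 0 i| <= rho) ->
  enorm x <= d%:R * rho.
Proof.
move=> xr; have [d0|d0] := posnP d.
  move: x xr; rewrite d0 => x _; rewrite mul0r /enorm big1 ?sqrtr0// => -[] //.
have r0 : 0 <= rho by exact: le_trans (xr (Ordinal d0)).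
rewrite -(ler_pXn2r (ltn0Sn 1)) ?nnegrE ?enorm_ge0 ?mulr_ge0// sqr_enorm.
apply: (@le_trans _ _ (\sum_(i < d) rho ^+ 2)).
  by apply: ler_sum => i _; rewrite -(real_normK (num_real _)) lerXn2r ?nnegrE.
rewrite sumr_const card_ord -[leLHS]mulr_natl exprMn ler_wpM2r ?sqr_ge0//.
by rewrite -natrX ler_nat leq_pmulr.
Qed.

Lemma enorm_eq0 x : enorm x = 0 -> x = 0.
Proof.
move=> x0; apply/rowP => i; rewrite mxE; apply/normr0_eq0/eqP.
by rewrite eq_le normr_ge0 andbT -x0 le_coord_enorm.
Qed.

Lemma cauchy_schwarz x y : \sum_(i < d) x 0 i * y 0 i <= enorm x * enorm y.
Proof.
have [/enorm_eq0 ->|x0] := eqVneq (enorm x) 0.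
  by rewrite enorm0 mul0r big1// => i _; rewrite mxE mul0r.
have [/enorm_eq0 ->|y0] := eqVneq (enorm y) 0.
  by rewrite enorm0 mulr0 big1// => i _; rewrite mxE mulr0.
have xy0 : 0 < enorm x * enorm y by rewrite mulr_gt0// lt_neqAle eq_sym ?x0 ?y0 enorm_ge0.
have : 0 <= \sum_(i < d) (enorm y * x 0 i - enorm x * y 0 i) ^+ 2.
  by apply: sumr_ge0 => i _; exact: sqr_ge0.
rewrite (eq_bigr (fun i => enorm y ^+ 2 * x 0 i ^+ 2 + enorm x ^+ 2 * y 0 i ^+ 2
   - 2 * (enorm x * enorm y) * (x 0 i * y 0 i))); last by move=> i _; ring.
rewrite big_split big_split /= sumrN -!mulr_sumr -!sqr_enorm.
rewrite subr_ge0 => h; rewrite -(ler_pM2l (x := 2 * (enorm x * enorm y))); last first.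
  by rewrite mulr_gt0.
by apply: le_trans h _; rewrite le_eqVlt; apply/orP; left; apply/eqP; ring.
Qed.

Lemma ler_enormD x y : enorm (x + y) <= enorm x + enorm y.
Proof.
rewrite -(ler_pXn2r (ltn0Sn 1)) ?nnegrE ?addr_ge0 ?enorm_ge0// sqr_enorm.
rewrite (eq_bigr (fun i => x 0 i ^+ 2 + y 0 i ^+ 2 + 2 * (x 0 i * y 0 i))); last first.
  by move=> i _; rewrite mxE; ring.
rewrite big_split big_split /= -mulr_sumr -!sqr_enorm.
have := cauchy_schwarz x y; nra.
Qed.

Lemma ler_enorm_dist x y z : enorm (x - z) <= enorm (x - y) + enorm (y - z).
Proof. by apply: le_trans (ler_enormD _ _); rewrite addrA subrK. Qed.

Definition eball a rho : set T := [set x | enorm (x - a) < rho].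

Lemma eball_center a rho : 0 < rho -> eball a rho a.
Proof. by move=> r0; rewrite /eball /= subrr enorm0. Qed.

(** The ball on the left is a sup-norm ball. Dividing by [d + 1] rather than [d] keeps the
    inequality strict and covers [d = 0]. *)
Lemma sub_ball_eball a rho : ball a (rho / d.+1%:R) `<=` eball a rho.
Proof.
move=> x [rd ax].
have r0 : 0 < rho by move: rd; rewrite pmulr_lgt0// invr_gt0.
rewrite /eball /=; apply: (@le_lt_trans _ _ (d%:R * (rho / d.+1%:R))).
  apply: enorm_le_coord => i; rewrite !mxE distrC.
  by have := ax ord0 i; rewrite -ball_normE /= => /ltW.
by rewrite mulrCA gtr_pMr// ltr_pdivrMr// mul1r ltr_nat.
Qed.

Lemma open_eball a rho : open (eball a rho).
Proof.
rewrite openE => x xa; have r0 : 0 < rho - enorm (x - a) by rewrite subr_gt0.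
rewrite /interior -nbhs_ballE; exists ((rho - enorm (x - a)) / d.+1%:R).
  by rewrite /= divr_gt0.
apply: subset_trans (@sub_ball_eball x _) _ => y /=; rewrite /eball /=.
by have := ler_enorm_dist y x a; lra.
Qed.

Lemma finite_net (Theta : set T) rho : compact Theta -> 0 < rho ->
  exists l : seq T, forall x, Theta x -> exists2 c, c \in l & eball c rho x.
Proof.
rewrite compact_cover => cT r0.
have [|D DT TD] := cT T Theta (eball ^~ rho) (fun c _ => @open_eball c rho).
  by move=> x Tx; exists x => //; exact: eball_center.
exists (finmap.enum_fset D) => x /TD[c /= Dc xc]; exists c => //.
Qed.

Lemma dense_rat (a : T) rho : 0 < rho ->
  exists q : 'rV[rat]_d, eball (map_mx ratr q) rho a.
Proof.
move=> r0; have rd : 0 < rho / d.+1%:R by rewrite divr_gt0.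
have /choice[f fP] : forall i, exists q : rat, `|a 0 i - ratr q| < rho / d.+1%:R.
  move: (rho / _) rd => e e0 i; have [|q] := @rat_in_itvoo R (a 0 i - e) (a 0 i + e).
    by lra.
  by rewrite in_itv /= => /andP[? ?]; exists q; rewrite ltr_norml; lra.
exists (\row_i f i); apply: sub_ball_eball; split=> // i j.
by rewrite !mxE ord1 -ball_normE /= distrC.
Qed.

Lemma borel_open (U : set T) : open U -> borel U.
Proof. by move=> oU; exact: sub_gen_smallest. Qed.

Lemma borelC (U : set T) : borel U -> borel (~` U).
Proof. exact: (@measurableC _ (g_sigma_algebraType [set U : set T | open U])). Qed.

Lemma borelT : borel (setT : set T).
Proof. exact: (@measurableT _ (g_sigma_algebraType [set U : set T | open U])). Qed.

Lemma borel_bigcup (F : nat -> set T) : (forall n, borel (F n)) -> borel (\bigcup_n F n).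
Proof.
move=> mF; apply: (@bigcupT_measurable _ (g_sigma_algebraType [set U : set T | open U])).
exact: mF.
Qed.

Lemma borel_set1 a : borel [set a].
Proof.
have -> : [set a] = ~` (\bigcup_n ~` eball a n.+1%:R^-1).
  rewrite setC_bigcup; apply/seteqP; split=> x /=.
    by move=> -> n _; rewrite setCK; apply: eball_center.
  move=> h; apply/eqP; rewrite -subr_eq0; apply/eqP/enorm_eq0/eqP.
  rewrite eq_le enorm_ge0 andbT leNgt; apply/negP => e0.
  have [n] := ltr_add_invr e0; rewrite add0r => ne.
  by have := h n I; rewrite setCK /eball /= => /lt_trans/(_ ne); rewrite ltxx.
apply: borelC; apply: borel_bigcup => n; apply: borelC; apply: borel_open.
exact: open_eball.
Qed.

End euclidean_norm.

Section borel_sets.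
Variables (R : realType) (d : nat).
Implicit Types (A B : set 'rV[R]_d).

Lemma borelU A B : borel A -> borel B -> borel (A `|` B).
Proof. exact: (@measurableU _ (g_sigma_algebraType [set U : set 'rV[R]_d | open U])). Qed.

Lemma borelI A B : borel A -> borel B -> borel (A `&` B).
Proof. exact: (@measurableI _ (g_sigma_algebraType [set U : set 'rV[R]_d | open U])). Qed.

Lemma borel_seq (l : seq 'rV[R]_d) : borel [set` l].
Proof.
elim: l => [|a l ih].
  by rewrite set_nil -setCT; apply: borelC; exact: borelT.
have -> : [set` a :: l] = [set a] `|` [set` l].
  by apply/seteqP; split=> x /=; rewrite inE => /predU1P.
apply: borelU => //; exact: borel_set1.
Qed.

End borel_sets.

(** * Sampling without replacement *)

Section nonneg_sums.
Variables (R : realType) (T : choiceType).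
Implicit Types (f : T -> R) (C : set T) (l : seq T).

Lemma sum_le_esum f C l : (forall x, 0 <= f x) -> uniq l -> [set` l] `<=` C ->
  ((\sum_(x <- l) f x)%:E <= \esum_(x in C) (f x)%:E)%E.
Proof.
move=> f0 ul lC; apply: esum_ge; exists [set` l]; first by split.
by rewrite -fsbig_seq// sumEFin.
Qed.

Lemma esum_gt_sum f C (t : R) : (t%:E < \esum_(x in C) (f x)%:E)%E ->
  exists l, [/\ uniq l, [set` l] `<=` C & t < \sum_(x <- l) f x].
Proof.
move=> /ereal_sup_gt[_ [A [finA AC] <-]]; rewrite fsbig_finite// sumEFin lte_fin.
move=> tA; exists (finmap.enum_fset (fset_set A)); split => //.
by move=> x /=; rewrite in_fset_set// inE => /AC.
Qed.

Lemma esum_seq f l : (forall x, 0 <= f x) -> uniq l ->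
  (\esum_(x in [set` l]) (f x)%:E = (\sum_(x <- l) f x)%:E)%E.
Proof.
move=> f0 ul; rewrite esum_fset//; last by move=> x _; rewrite lee_fin.
by rewrite -fsbig_seq// sumEFin.
Qed.

End nonneg_sums.

(** * Masses of sets and the law of finitely many draws *)

Section mass_of_sets.
Variables (R : realType) (d : nat) (G : dprob R d).
Local Notation T := 'rV[R]_d.
Implicit Types (C : set T) (l h : seq T) (s : seq (option T)).

Definition set_mass C : R := fine (\esum_(x in C) (G x)%:E)%E.

Lemma esum_mass_le1 C : (\esum_(x in C) (G x)%:E <= 1)%E.
Proof.
rewrite -(mass_sum1 G) [leRHS](esumID C).
  by rewrite setTI leeDl// esum_ge0// => *; rewrite lee_fin mass_ge0.
by move=> *; rewrite lee_fin mass_ge0.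
Qed.

Lemma set_massE C : ((set_mass C)%:E = \esum_(x in C) (G x)%:E)%E.
Proof.
rewrite fineK// ge0_fin_numE.
  by rewrite (le_lt_trans (esum_mass_le1 C))// ltry.
by rewrite esum_ge0// => *; rewrite lee_fin mass_ge0.
Qed.

Lemma set_mass_ge0 C : 0 <= set_mass C.
Proof. by rewrite -lee_fin set_massE esum_ge0// => *; rewrite lee_fin mass_ge0. Qed.

Lemma set_mass_le1 C : set_mass C <= 1.
Proof. by rewrite -lee_fin set_massE esum_mass_le1. Qed.

Lemma set_massT : set_mass setT = 1.
Proof. by rewrite /set_mass mass_sum1. Qed.

Lemma set_massD C1 C2 : C1 `&` C2 = set0 ->
  set_mass (C1 `|` C2) = set_mass C1 + set_mass C2.
Proof.
move=> C12; apply: EFin_inj; rewrite EFinD !set_massE (esumID C1).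
  by congr (_ + _)%E; congr esum; apply/seteqP; split=> x /=; 
    have : ~ (C1 `&` C2) x by [rewrite C12]; rewrite /setI /=; tauto.
by move=> *; rewrite lee_fin mass_ge0.
Qed.

Lemma le_set_mass C1 C2 : C1 `<=` C2 -> set_mass C1 <= set_mass C2.
Proof.
move=> C12; have -> : C2 = C1 `|` (C2 `\` C1) by rewrite setDUK.
by rewrite set_massD ?setDIK// lerDl set_mass_ge0.
Qed.

Lemma sum_le_set_mass C l : uniq l -> [set` l] `<=` C ->
  \sum_(x <- l) G x <= set_mass C.
Proof.
by move=> ul lC; rewrite -lee_fin set_massE sum_le_esum// => x; exact: mass_ge0.
Qed.

Lemma set_mass_seq l : uniq l -> set_mass [set` l] = \sum_(x <- l) G x.
Proof. by move=> ul; rewrite /set_mass esum_seq// => x; exact: mass_ge0. Qed.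

Lemma set_mass_approx C (e : R) : 0 < e ->
  exists l, [/\ uniq l, [set` l] `<=` C & set_mass C - e < \sum_(x <- l) G x].
Proof.
by move=> e0; apply: esum_gt_sum; rewrite -set_massE lte_fin gtrBl.
Qed.

Lemma sum_mass_le1 l : uniq l -> \sum_(x <- l) G x <= 1.
Proof. by move=> ul; rewrite -set_massT sum_le_set_mass. Qed.

Lemma draws_prob_rcons h s x : draws_prob G h (rcons s x) =
  draws_prob G h s * draw_prob G (h ++ pmap id s) x.
Proof.
elim: s h => [h|[a|] s ih h] /=; first by rewrite cats0 mul1r mulr1.
  by rewrite ih mulrA cat_rcons.
by rewrite ih mulrA.
Qed.

Lemma draws_prob_valid s : draws_prob G [::] s != 0 ->
  uniq (pmap id s) /\ forall a, a \in pmap id s -> 0 < G a.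
Proof.
elim/last_ind: s => // s o ih; rewrite draws_prob_rcons mulf_eq0 negb_or cat0s.
move=> /andP[/ih[us Gs]]; rewrite -cats1 pmap_cat.
case: o => [a|] /=; last by rewrite cats0.
case: ifPn => [|as_]; first by rewrite eqxx.
rewrite mulf_eq0 negb_or => /andP[Ga _]; rewrite cats1 rcons_uniq as_ us; split=> //.
move=> b; rewrite mem_rcons inE => /predU1P[->|/Gs//].
by rewrite lt_neqAle mass_ge0 andbT eq_sym.
Qed.

(** Infinitely many atoms may remain, so a finite list of outcomes carries only almost all of the
    conditional probability. Once the drawn mass is 1, the single outcome [None] suffices. *)
Lemma draw_prob_total h (e : R) : uniq h -> 0 < e ->
  exists l : seq (option T), uniq l /\ 1 - e < \sum_(o <- l) draw_prob G h o.
Proof.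
move=> uh e0; have := sum_mass_le1 uh; set S := \sum_(b <- h) G b => S1.
have [S1'|S1'] := eqVneq S 1.
  exists [:: None]; split=> //.
  by rewrite big_seq1 /= -/S S1' subrr eqxx gtrBl.
have L0 : 0 < 1 - S by rewrite subr_gt0 lt_neqAle S1'.
have [l [ul _]] := set_mass_approx setT (mulr_gt0 e0 L0).
rewrite set_massT => lG.
exists [seq Some a | a <- l & a \notin h]; split.
  by rewrite map_inj_uniq ?filter_uniq// => ? ? [].
rewrite big_map big_filter /= (eq_bigr (fun a => G a / (1 - S))); last first.
  by move=> a /negbTE ->.
rewrite -mulr_suml ltr_pdivlMr//.
have : \sum_(x <- l) G x <= \sum_(x <- l | x \notin h) G x + S.
  rewrite (bigID [pred x | x \notin h]) /= lerD2l -big_filter.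
  rewrite /S -(set_mass_seq uh) sum_le_set_mass ?filter_uniq//.
  by move=> x /=; rewrite mem_filter negbK => /andP[].
by lra.
Qed.

End mass_of_sets.

(** * The random order of the atoms of a fixed measure *)

Section random_order.
Variables (R : realType) (d : nat) (G : dprob R d).
Local Notation T := 'rV[R]_d.
Variables (dE : measure_display) (E : measurableType dE) (nu : probability E R).
Variable o : E -> nat -> option T.
Hypothesis o_meas : forall j B, borel B ->
  measurable [set u | exists2 a, B a & o u j = Some a].
Hypothesis o_law : forall s,
  nu [set u | forall j, (j < size s)%N -> o u j = nth None s j] =
  (draws_prob G [::] s)%:E.

Definition agree (s : seq (option T)) : set E := [set u | mkseq (o u) (size s) = s].

Definition prob (A : set E) : R := fine (nu A).

Lemma probE A : measurable A -> ((prob A)%:E = nu A)%E.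
Proof. by move=> mA; rewrite fineK// fin_num_measure. Qed.

Lemma prob_ge0 A : 0 <= prob A.
Proof. by rewrite fine_ge0. Qed.

Lemma probU A B : measurable A -> measurable B -> A `&` B = set0 ->
  prob (A `|` B) = prob A + prob B.
Proof.
move=> mA mB AB; apply: EFin_inj; rewrite EFinD !probE ?measureU//.
exact: measurableU.
Qed.

Lemma le_prob A B : measurable A -> measurable B -> A `<=` B -> prob A <= prob B.
Proof. by move=> mA mB AB; rewrite -lee_fin !probE// le_measure ?inE. Qed.

Lemma prob0 : prob set0 = 0. Proof. by rewrite /prob measure0. Qed.

Lemma probT : prob setT = 1. Proof. by rewrite /prob probability_setT. Qed.

Lemma prob_split A B : measurable A -> measurable B ->
  prob A = prob (A `&` B) + prob (A `&` ~` B).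
Proof.
move=> mA mB; rewrite -probU; first by rewrite -setIUr setUv setIT.
- exact: measurableI.
- by apply: measurableI => //; exact: measurableC.
- by rewrite setIACA setICr setI0.
Qed.

Lemma measurable_draw j x : measurable [set u | o u j = x].
Proof.
case: x => [a|].
  have -> : [set u | o u j = Some a] = [set u | exists2 b, [set a] b & o u j = Some b].
    by apply/seteqP; split=> u /=; [exists a | move=> [b ->]].
  by apply: o_meas; exact: borel_set1.
have -> : [set u | o u j = None] =
    ~` [set u | exists2 b, (setT : set T) b & o u j = Some b].
  apply/seteqP; split=> u /=; first by move=> -> [].
  by case: (o u j) => // a h; exfalso; apply: h; exists a.
by apply: measurableC; apply: o_meas; exact: borelT.
Qed.

Lemma agree_rcons s x : agree (rcons s x) = agree s `&` [set u | o u (size s) = x].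
Proof.
apply/seteqP; split=> u; rewrite /agree /= size_rcons mkseqS.
  by move=> /rcons_inj[].
by move=> [-> ->].
Qed.

Lemma agree_nil : agree [::] = setT.
Proof. by apply/seteqP; split. Qed.

Lemma measurable_agree s : measurable (agree s).
Proof.
elim/last_ind: s => [|s x ih]; first by rewrite agree_nil.
by rewrite agree_rcons; apply: measurableI => //; exact: measurable_draw.
Qed.
Hint Resolve measurable_agree : core.

Lemma prob_agree s : prob (agree s) = draws_prob G [::] s.
Proof.
rewrite /prob -[RHS]/(fine (draws_prob G [::] s)%:E) -o_law; congr (fine (nu _)).
apply/seteqP; split=> u; rewrite /agree /=.
  by move=> us j js; rewrite -[s in RHS]us nth_mkseq.
by move=> us; apply: (@eq_from_nth _ None); rewrite size_mkseq// => j js; rewrite nth_mkseq// us.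
Qed.

Definition draw_notin j (l : seq (option T)) : set E := [set u | o u j \notin l].

Lemma draw_notin_cons j x l : draw_notin j (x :: l) =
  draw_notin j l `&` ~` [set u | o u j = x].
Proof.
apply/seteqP; split=> u; rewrite /draw_notin /= inE negb_or.
  by move=> /andP[/eqP].
by move=> [-> /eqP ->].
Qed.

Lemma measurable_draw_notin j l : measurable (draw_notin j l).
Proof.
elim: l => [|x l ih]; first by rewrite (_ : draw_notin _ _ = setT)//; apply/seteqP; split.
rewrite draw_notin_cons; apply: measurableI => //; apply: measurableC.
exact: measurable_draw.
Qed.

Lemma prob_next A s l : measurable A -> uniq l ->
  prob (A `&` agree s) = \sum_(x <- l) prob (A `&` agree (rcons s x)) +
    prob (A `&` agree s `&` draw_notin (size s) l).
Proof.
move=> mA; elim: l => [|x l ih].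
  rewrite big_nil add0r (_ : draw_notin _ _ = setT) ?setIT//.
  by apply/seteqP; split.
move=> /= /andP[xl ul]; rewrite big_cons ih// addrAC addrC; congr (_ + _).
rewrite [LHS](@prob_split _ [set u | o u (size s) = x]).
- congr (prob _ + prob _).
    rewrite agree_rcons setIA -!setIA; congr (_ `&` (_ `&` _)).
    by apply/seteqP; split=> u; rewrite /draw_notin /=; [move=> [] | move=> ->].
  by rewrite draw_notin_cons !setIA.
- by do !apply: measurableI => //; exact: measurable_draw_notin.
- exact: measurable_draw.
Qed.

(* The next draw leaves a large enough finite set with small probability, so
   inequalities between (scaled) probabilities can be checked one draw later. *)
Lemma le_prob_next (c1 c2 : R) A B s : 0 <= c1 -> 0 <= c2 ->
  measurable A -> measurable B ->
  (forall x, c1 * prob (A `&` agree (rcons s x)) <=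
             c2 * prob (B `&` agree (rcons s x))) ->
  c1 * prob (A `&` agree s) <= c2 * prob (B `&` agree s).
Proof.
move=> c10 c20 mA mB h.
have [s0|s0] := eqVneq (draws_prob G [::] s) 0.
  have -> : prob (A `&` agree s) = 0.
    apply/eqP; rewrite eq_le prob_ge0 andbT -s0 -prob_agree le_prob//.
    exact: measurableI.
  by rewrite mulr0 mulr_ge0// prob_ge0.
have [us _] := draws_prob_valid s0.
apply/ler_addgt0Pr => e e0.
(* The probability lost outside [l] is multiplied by [c1], which may vanish, hence the divisor
   [c1 + 1]. *)
have ec : 0 < e / (c1 + 1) by rewrite divr_gt0// ltr_wpDl.
have [l [ul le]] := draw_prob_total G us ec.
rewrite (prob_next s mA ul) (prob_next s mB ul) !mulrDr -addrA lerD//.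
  by rewrite !mulr_sumr ler_sum.
apply: ler_wpDl; first by rewrite mulr_ge0// prob_ge0.
have : prob (A `&` agree s `&` draw_notin (size s) l) <= e / (c1 + 1).
  apply: (@le_trans _ _ (prob (setT `&` agree s `&` draw_notin (size s) l))).
    have md := measurable_draw_notin (size s) l.
    by apply: le_prob; [do !apply: measurableI => // | do !apply: measurableI => //|
      rewrite setTI -setIA; apply: subIsetr].
  have := prob_next s measurableT ul.
  under eq_bigr => x _ do rewrite setTI prob_agree draws_prob_rcons cat0s.
  rewrite -mulr_sumr setTI prob_agree.
  have : draws_prob G [::] s <= 1.
    by rewrite -prob_agree -probT le_prob.
  have : 0 <= draws_prob G [::] s by rewrite -prob_agree prob_ge0.
  move: le ec; set p := draws_prob _ _ _; set q := prob (_ `&` _).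
  set S := \sum_(_ <- _) _; move: (e / _) => e' le ec p0 p1 pq.
  have : p * (1 - S) <= 1 * e'.
    apply: (@le_trans _ _ (p * e')); first by rewrite ler_wpM2l//; lra.
    by rewrite ler_wpM2r// ltW.
  by lra.
move=> /(ler_wpM2l c10)/le_trans; apply.
rewrite mulrA ler_pdivrMr ?ltr_wpDl// mulrDr mulr1 mulrC lerDl.
exact: ltW.
Qed.

(** Backward induction on the length of the history: a comparison valid after [m] draws descends to
    the empty history, without any sum over the possibly infinite set of histories. *)
Lemma le_prob_agree (c1 c2 : R) A B m : 0 <= c1 -> 0 <= c2 ->
  measurable A -> measurable B ->
  (forall s, size s = m -> c1 * prob (A `&` agree s) <= c2 * prob (B `&` agree s)) ->
  c1 * prob A <= c2 * prob B.
Proof.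
move=> c10 c20 mA mB.
suff : forall k, (forall s, size s = k -> c1 * prob (A `&` agree s) <= c2 * prob (B `&` agree s)) ->
    c1 * prob A <= c2 * prob B by apply.
elim => [/(_ [::] erefl)|k ih h]; first by rewrite agree_nil !setIT.
by apply: ih => s sk; apply: le_prob_next => // x; apply: h; rewrite size_rcons sk.
Qed.

(** This turns almost sure properties of the order into facts about finite lists of positive
    probability. *)
Lemma prob_null A m : measurable A ->
  (forall s, size s = m -> draws_prob G [::] s != 0 -> A `&` agree s = set0) ->
  prob A = 0.
Proof.
move=> mA h; apply/eqP; rewrite eq_le prob_ge0 andbT -[leLHS]mul1r -(mul0r (prob A)).
apply: (@le_prob_agree _ _ _ _ m) => // s sm; rewrite mul1r mul0r.
have [s0|s0] := eqVneq (draws_prob G [::] s) 0.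
  by rewrite -s0 -prob_agree le_prob//; exact: measurableI.
by rewrite h// prob0.
Qed.

Definition drawn_in j (C : set T) : set E := [set u | exists2 a, C a & o u j = Some a].

(** As long as [a] is missing, each draw picks it with conditional probability at least [G a], so it
    is still missing after [m] draws with probability at most [(1 - G a) ^+ m]. *)
Lemma prob_never_drawn a : 0 < G a -> prob [set u | forall j, o u j != Some a] = 0.
Proof.
move=> Ga; pose A m := [set u | forall j, (j < m)%N -> o u j != Some a].
have AS m : A m.+1 = A m `&` ~` [set u | o u m = Some a].
  apply/seteqP; split=> u; rewrite /A /= => h.
    by split=> [j jm|]; [exact: h (ltnW _) | exact/eqP/h].
  case: h => h1 h2 j; rewrite ltnS leq_eqVlt => /predU1P[->|]; [exact/eqP|exact: h1].
have mA m : measurable (A m).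
  elim: m => [|m ih]; first by rewrite (_ : A 0%N = setT)//; apply/seteqP; split.
  by rewrite AS; apply: measurableI => //; apply: measurableC; exact: measurable_draw.
have G1 : G a <= 1 by have := @sum_mass_le1 _ _ G [:: a] isT; rewrite big_seq1.
have le m : prob (A m) <= (1 - G a) ^+ m.
  elim: m => [|m ih]; first by rewrite expr0 -probT le_prob.
  apply: (@le_trans _ _ ((1 - G a) * prob (A m))); last first.
    by rewrite exprS ler_wpM2l// subr_ge0.
  rewrite -[leLHS]mul1r; apply: (@le_prob_agree _ _ _ _ m) => //.
    by rewrite subr_ge0.
  move=> s sm; rewrite mul1r AS.
  have [sa|sa] := boolP (Some a \in s).
    rewrite [X in prob X](_ : _ = set0); first by rewrite prob0 mulr_ge0// ?subr_ge0// prob_ge0.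
    apply/seteqP; split=> u // [[Au _]]; rewrite /agree /= sm => us.
    by move: sa; rewrite -us => /mapP[j]; rewrite mem_iota => jm /esym/eqP; apply/negP/Au.
  have As : A m `&` agree s = agree s.
    apply/setIidPr => u; rewrite /agree /= sm => us j jm.
    apply: contraNneq sa => <-; rewrite -us; apply/mapP; exists j => //.
    by rewrite mem_iota.
  rewrite As setIAC As prob_agree.
  have := @prob_split (agree s) [set u | o u m = Some a] (measurable_agree _) (measurable_draw _ _).
  have -> : agree s `&` [set u | o u m = Some a] = agree (rcons s (Some a)).
    by rewrite agree_rcons sm.
  rewrite !prob_agree draws_prob_rcons cat0s /=.
  have [s0|s0] := eqVneq (draws_prob G [::] s) 0.
    by rewrite s0 mul0r add0r mulr0 => <-.
  have [us _] := draws_prob_valid s0.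
  rewrite ifF; last first.
    by apply/negbTE; apply: contra sa; rewrite mem_pmap map_id.
  have : 0 <= draws_prob G [::] s by rewrite -prob_agree prob_ge0.
  move: (draws_prob G [::] s) => p p0.
  have aS : \sum_(b <- a :: pmap id s) G b <= 1.
    apply: sum_mass_le1 => /=; rewrite us andbT.
    by apply: contra sa; rewrite mem_pmap map_id.
  have S0 : 0 <= \sum_(b <- pmap id s) G b by apply: sumr_ge0 => *; exact: mass_ge0.
  move: aS; rewrite big_cons; move: (\sum_(b <- _) _) S0 => S S0 aS pe.
  (* Dividing by the remaining mass, which is at most 1, only raises the chance of [a]. *)
  have : G a <= G a / (1 - S).
    by rewrite ler_pdivlMr; [nra|lra].
  move=> /(ler_wpM2l p0); lra.
have mN : measurable [set u | forall j, o u j != Some a].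
  rewrite (_ : [set u | _] = \bigcap_m A m); first exact: bigcapT_measurable.
  apply/seteqP; split=> u /= h; first by move=> m _ j _; exact: h.
  by move=> j; exact: (h j.+1 I j (ltnSn j)).
apply/eqP; rewrite eq_le prob_ge0 andbT; apply/ler_addgt0Pl => e e0; rewrite addr0.
have : (1 - G a) ^+ n @[n --> \oo] --> (0 : R).
  by apply: cvg_expr; rewrite ger0_norm; lra.
move=> /cvgrPdist_lt/(_ e e0)[N _ /(_ N (leqnn N))] /=; rewrite sub0r normrN => Ne.
apply: le_trans (ltW (le_lt_trans (ler_norm _) Ne)).
apply: le_trans (le N); apply: le_prob => // u h j _; exact: h.
Qed.

(** Finite subsets of [C] give a lower bound only; upper bounds come from applying it to a
    complement. Multiplying by the remaining mass, instead of dividing, covers the exhausted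
    history. *)
Lemma ge_prob_drawn_in C s : borel C -> draws_prob G [::] s != 0 ->
  [set` pmap id s] `<=` ~` C ->
  draws_prob G [::] s * set_mass G C <=
  prob (drawn_in (size s) C `&` agree s) * (1 - \sum_(b <- pmap id s) G b).
Proof.
move=> bC s0 sC; have [us _] := draws_prob_valid s0.
have p0 : 0 <= draws_prob G [::] s by rewrite -prob_agree prob_ge0.
have CS : set_mass G C + \sum_(b <- pmap id s) G b <= 1.
  rewrite -set_mass_seq// -set_massD ?set_mass_le1//.
  by apply/seteqP; split=> a // [Ca /sC].
have mD : measurable (drawn_in (size s) C) by exact: o_meas.
have [S1|S1] := eqVneq (\sum_(b <- pmap id s) G b) 1.
  have -> : set_mass G C = 0.
    by apply/eqP; rewrite eq_le set_mass_ge0 andbT; lra.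
  by rewrite S1 subrr !mulr0.
apply/ler_addgt0Pr => e e0.
have [l [ul lC lG]] := set_mass_approx G C e0.
have ul' : uniq [seq Some a | a <- l] by rewrite map_inj_uniq// => ? ? [].
rewrite (prob_next s mD ul') mulrDl big_map.
have -> : \sum_(a <- l) prob (drawn_in (size s) C `&` agree (rcons s (Some a))) =
    \sum_(a <- l) (draws_prob G [::] s / (1 - \sum_(b <- pmap id s) G b)) * G a.
  apply: eq_big_seq => a al.
  have -> : drawn_in (size s) C `&` agree (rcons s (Some a)) = agree (rcons s (Some a)).
    apply/setIidPr => u; rewrite agree_rcons => -[_ /= oa]; exists a => //.
    exact: lC.
  rewrite prob_agree draws_prob_rcons cat0s /= ifF; first by rewrite mulrA mulrAC.
  by apply/negbTE/negP => /sC; apply; exact: lC.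
rewrite -mulr_sumr [_ / _ * _ in leRHS]mulrAC divfK; last by rewrite subr_eq0 eq_sym.
have : draws_prob G [::] s <= 1 by rewrite -prob_agree -probT le_prob.
have : 0 <= prob (drawn_in (size s) C `&` agree s `&` draw_notin (size s)
         [seq Some a | a <- l]) * (1 - \sum_(b <- pmap id s) G b).
  apply: mulr_ge0; first exact: prob_ge0.
  by have := set_mass_ge0 G C; lra.
move: (prob _ * _) => q q0 p1.
move: (draws_prob G [::] s) p0 p1 => p p0 p1.
have : p * (set_mass G C - e) <= p * \sum_(x <- l) G x by rewrite ler_wpM2l// ltW.
have : p * e <= 1 * e by rewrite ler_wpM2r// ltW.
by lra.
Qed.

Definition first_in (C : set T) j (C' : set T) : set E :=
  [set u | (forall i, (i < j)%N -> ~ drawn_in i C u) /\ drawn_in j C' u].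

Lemma measurable_first_in C j C' : borel C -> borel C' ->
  measurable (first_in C j C').
Proof.
move=> bC bC'; apply: measurableI; last exact: o_meas.
rewrite (_ : (fun u => _) = \bigcap_(i in [set i | (i < j)%N]) ~` drawn_in i C)//.
by apply: bigcap_measurableType => // i _; apply: measurableC; exact: o_meas.
Qed.

Lemma first_in_agree C C' s : C' `<=` C ->
  first_in C (size s) C' `&` agree s =
  if `[< [set` pmap id s] `<=` ~` C >] then drawn_in (size s) C' `&` agree s else set0.
Proof.
move=> CC'; case: ifPn => [/asboolP sC|/asboolPn sC]; apply/seteqP; split => u //.
- by move=> [[]].
- move=> [uC us]; split=> //; split=> // i si [a Ca ua].
  apply: (sC a) => //=; rewrite mem_pmap map_id.
  by move: us; rewrite /agree /= => <-; apply/mapP; exists i; rewrite ?mem_iota.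
- move=> [[h _] us]; apply: sC => a /=; rewrite mem_pmap map_id => sa Ca.
  move: us sa; rewrite /agree /= => {1}<- /mapP[i]; rewrite mem_iota => si ia.
  by apply: (h i si); exists a.
Qed.

(* At each step the chances of drawing from [C1] and from [C2] are in the ratio
   of their masses, as long as neither has been hit. *)
Lemma prob_first_in_ratio C1 C2 j : borel C1 -> borel C2 -> C1 `&` C2 = set0 ->
  set_mass G C1 * prob (first_in (C1 `|` C2) j C2) <=
  set_mass G C2 * prob (first_in (C1 `|` C2) j C1).
Proof.
move=> b1 b2 C12; have b12 : borel (C1 `|` C2).
  exact: borelU.
apply: (@le_prob_agree _ _ _ _ j); rewrite ?set_mass_ge0//.
- exact: measurable_first_in.
- exact: measurable_first_in.
move=> s sj; rewrite -sj !first_in_agree; [|exact: subsetUl|exact: subsetUr].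
case: ifPn => [/asboolP sC|_]; last by rewrite prob0 !mulr0.
have [s0|s0] := eqVneq (draws_prob G [::] s) 0.
  have z C : borel C -> prob (drawn_in (size s) C `&` agree s) = 0.
    move=> bC; apply/eqP; rewrite eq_le prob_ge0 andbT -s0 -prob_agree le_prob//.
    by apply: measurableI => //; exact: o_meas.
  by rewrite !z// !mulr0.
have sC1 : [set` pmap id s] `<=` ~` C1 by move=> a /sC h C1a; apply: h; left.
have sC2 : [set` pmap id s] `<=` ~` C2 by move=> a /sC h C2a; apply: h; right.
have h1 := ge_prob_drawn_in b1 s0 sC1.
(* The undrawn points outside [C2]: the lower bound for hitting [C3] is an upper bound for hitting
   [C2]. *)
pose C3 := ~` C2 `&` ~` [set` pmap id s].
have b3 : borel C3.
  by apply: borelI; apply: borelC => //; exact: borel_seq.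
have [us _] := draws_prob_valid s0.
have h3 := ge_prob_drawn_in b3 s0 _.
have {h3} := h3 (subset_trans _ (@subsetC _ _ _ (@subIsetr _ _ _))).
rewrite setCK => /(_ (@subset_refl _ _)) h3.
have e3 : set_mass G C2 + set_mass G C3 + \sum_(b <- pmap id s) G b = 1.
  rewrite -set_mass_seq// -!set_massD.
  - rewrite -(set_massT G); congr set_mass; apply/seteqP; split=> // a _.
    rewrite /C3 /setU /setI /setC /=.
    by have [|] := pselect (C2 a); have [|] := pselect (a \in pmap id s); tauto.
  - by apply/seteqP; split=> a // [[C2a /sC2|[_ h] /h]].
  - by apply/seteqP; split=> a // [C2a []].
have h23 : prob (drawn_in (size s) C2 `&` agree s) +
    prob (drawn_in (size s) C3 `&` agree s) <= draws_prob G [::] s.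
  have m2 : measurable (drawn_in (size s) C2) by exact: o_meas.
  have m3 : measurable (drawn_in (size s) C3) by exact: o_meas.
  rewrite -prob_agree -probU; [|exact: measurableI|exact: measurableI|].
    apply: le_prob => //; first by apply: measurableU; exact: measurableI.
    by move=> u [[]|[]].
  apply/seteqP; split=> u // [[[a C2a ua] _] [[b [C2b _] ub] _]].
  by apply: C2b; move: ub; rewrite ua => -[<-].
have := prob_ge0 (drawn_in (size s) C1 `&` agree s).
have := prob_ge0 (drawn_in (size s) C2 `&` agree s).
have := prob_ge0 (drawn_in (size s) C3 `&` agree s).
have : 0 <= draws_prob G [::] s by rewrite -prob_agree prob_ge0.
have := set_mass_ge0 G C1; have := set_mass_ge0 G C2; have := set_mass_ge0 G C3.
have C13 : set_mass G C1 <= set_mass G C3.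
  apply: le_set_mass => a C1a; split=> [C2a|/sC1//].
  by have : (C1 `&` C2) a by []; rewrite C12.
move: h1 h3 e3 h23 C13.
move: (prob _) (prob _) (prob _) (set_mass _ _) (set_mass _ _) (set_mass _ _) (draws_prob _ _ _).
move: (\sum_(b <- _) _) => S p2 p3 p1 g2 g3 g1 p h1 h3 e3 h23 C13 *.
(* If no mass is left, [C2] and [C3] are massless, and so is [C1], whose mass is at most that of
   [C3]. *)
have [L0|L0] := ltrP 0 (1 - S); last by have [-> ->] : g1 = 0 /\ g2 = 0; lra.
rewrite -(ler_pM2r L0).
have q2 : p2 * (1 - S) <= p * g2.
  by have : (p2 + p3) * (1 - S) <= p * (1 - S) by [rewrite ler_wpM2r// ltW]; nra.
apply: (@le_trans _ _ (g1 * (p * g2))); first by rewrite -mulrA ler_wpM2l.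
by rewrite (_ : g1 * _ = g2 * (p * g1)) -?mulrA ?ler_wpM2l//; ring.
Qed.

Lemma first_in_disjoint C j k C1 C2 : C1 `<=` C -> (j < k)%N ->
  first_in C j C1 `&` first_in C k C2 = set0.
Proof.
move=> C1C jk; apply/seteqP; split=> u // [[_ [a C1a ua]] [h _]].
by apply: (h j jk); exists a => //; exact: C1C.
Qed.

(** Sum the ratio inequality over the time [j] of the first hit. The events that [C1] is hit first
    at time [j] are disjoint, so their probabilities add up to at most 1. *)
Lemma prob_first_in_le C1 C2 : borel C1 -> borel C2 -> C1 `&` C2 = set0 ->
  0 < set_mass G C1 ->
  prob (\bigcup_j first_in (C1 `|` C2) j C2) <= set_mass G C2 / set_mass G C1.
Proof.
move=> b1 b2 C12 G1; have b12 : borel (C1 `|` C2).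
  exact: borelU.
have m2 j : measurable (first_in (C1 `|` C2) j C2) by exact: measurable_first_in.
have m1 j : measurable (first_in (C1 `|` C2) j C1) by exact: measurable_first_in.
have mU : measurable (\bigcup_j first_in (C1 `|` C2) j C2) by exact: bigcupT_measurable.
rewrite -lee_fin probE//.
apply: (le_trans (@measure_sigma_subadditive _ _ _ nu _ _ m2 mU (@subset_refl _ _))).
apply: lime_le; first exact: is_cvg_nneseries.
apply: nearW => n /=.
rewrite (eq_bigr (fun j => (prob (first_in (C1 `|` C2) j C2))%:E)); last first.
  by move=> j _; rewrite probE.
rewrite sumEFin lee_fin ler_pdivlMr// mulrC mulr_sumr.
apply: (@le_trans _ _ (\sum_(0 <= j < n) set_mass G C2 * prob (first_in (C1 `|` C2) j C1))).
  by apply: ler_sum => j _; exact: prob_first_in_ratio.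
rewrite -mulr_sumr ler_piMr ?set_mass_ge0//.
have -> : \sum_(0 <= j < n) prob (first_in (C1 `|` C2) j C1) =
   prob (\big[setU/set0]_(0 <= j < n) first_in (C1 `|` C2) j C1).
  elim: n => [|n ih]; first by rewrite !big_nil prob0.
  rewrite !big_nat_recr//= ih probU//.
    by apply: bigsetU_measurable => *.
  rewrite setIC big_distrr /= big_nat big1// => j /= jn.
  by rewrite setIC; apply: first_in_disjoint => //; exact: subsetUl.
by rewrite -probT le_prob//; apply: bigsetU_measurable => *.
Qed.

End random_order.

(** * Joint measurability in the measure and the seed *)

Lemma ler_sum_sub (R : realType) (T : choiceType) (f : T -> R) (l1 l2 : seq T) :
  (forall x, 0 <= f x) -> uniq l1 -> uniq l2 -> {subset l1 <= l2} ->
  \sum_(x <- l1) f x <= \sum_(x <- l2) f x.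
Proof.
by move=> f0 u1 u2 l12; rewrite -lee_fin -[leRHS]esum_seq// sum_le_esum.
Qed.

Lemma pmap_id_uniq_nth (T : eqType) (s : seq (option T)) j k a :
  uniq (pmap id s) -> nth None s j = Some a -> nth None s k = Some a -> j = k.
Proof.
have h (s' : seq (option T)) i : nth None s' i = Some a -> a \in pmap id s'.
  move=> ia; rewrite mem_pmap map_id -ia mem_nth// ltnNge.
  by apply/negP => /(nth_default None); rewrite ia.
elim: s j k => [|x s ih] [|j] [|k] //= us.
- by move=> xa /h sa; move: us; rewrite xa /= sa.
- by move=> /h sa xa; move: us; rewrite xa /= sa.
- by move=> ja ka; congr _.+1; apply: ih ja ka; case: x us => //= b /andP[].
Qed.

(** * A countable base of balls *)

Section countable_base.
Variables (R : realType) (d : nat).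
Local Notation T := 'rV[R]_d.

(* [G a < t] iff some [rat_ball] around [a] has [G]-mass less than [t]; this is
   what makes the mass of a randomly drawn atom measurable. *)
Definition rat_ball (i : 'rV[rat]_d * nat) : set T :=
  eball (map_mx ratr i.1) i.2.+1%:R^-1.

Lemma borel_rat_ball i : borel (rat_ball i).
Proof. by apply: borel_open; exact: open_eball. Qed.

Lemma rat_ball_small (a : T) (rho : R) : 0 < rho ->
  exists2 i, rat_ball i a & rat_ball i `<=` eball a rho.
Proof.
move=> r0; have r2 : 0 < rho / 2 by rewrite divr_gt0.
have [k] := ltr_add_invr r2; rewrite add0r => kr.
have [q qa] : exists q : 'rV[rat]_d, eball (map_mx ratr q) k.+1%:R^-1 a.
  exact: dense_rat.
exists (q, k) => // x; rewrite /rat_ball /eball /= => qx.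
move: qa; rewrite /eball /= enormB => qa.
have := ler_enorm_dist x (map_mx ratr q) a.
move: (k.+1%:R^-1) kr qa qx => e; lra.
Qed.

Lemma finite_isolated (l : seq T) (a : T) :
  exists2 rho : R, 0 < rho & forall x, x \in l -> x != a -> rho <= enorm (x - a).
Proof.
elim: l => [|b l [rho r0 ih]]; first by exists 1.
have [->|ba] := eqVneq b a.
  by exists rho => // x; rewrite inE => /predU1P[->|/ih//]; rewrite eqxx.
exists (Num.min rho (enorm (b - a))).
  rewrite lt_min r0 lt_neqAle enorm_ge0 eq_sym andbT.
  by apply: contra ba => /eqP/enorm_eq0/eqP; rewrite subr_eq0.
move=> x; rewrite inE ge_min => /predU1P[-> _|xl xa]; first by rewrite lexx orbT.
by rewrite ih.
Qed.

(** All mass up to [t - G a] sits on a finite list, and a small enough ball around [a] contains no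
    other point of that list. *)
Lemma set_mass_eball_lt (G : dprob R d) (a : T) (t : R) : G a < t ->
  exists2 rho, 0 < rho & set_mass G (eball a rho) < t.
Proof.
rewrite -subr_gt0 => ta; have [l [ul _]] := set_mass_approx G setT ta.
rewrite set_massT => lG; have [rho r0 lr] := finite_isolated l a.
exists rho => //.
have : set_mass G (eball a rho) + \sum_(x <- l | x != a) G x <= 1.
  rewrite -big_filter -set_mass_seq ?filter_uniq// -set_massD ?set_mass_le1//.
  apply/seteqP; split=> x //= [xa]; rewrite mem_filter => /andP[xa' xl].
  by have := lt_le_trans xa (lr x xl xa'); rewrite ltxx.
have : \sum_(x <- l | x == a) G x <= G a.
  rewrite -big_filter -[leRHS](big_seq1 +%R a G) -(set_mass_seq G (l := [:: a]))//.
  apply: sum_le_set_mass; rewrite ?filter_uniq// => x /=.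
  by rewrite mem_filter inE => /andP[].
move: lG; rewrite (bigID (pred1 a)) /=; lra.
Qed.

Lemma measurable_set_mass_lt (C : set T) (t : R) : borel C ->
  measurable [set G : dprob R d | set_mass G C < t].
Proof.
move=> bC; apply: sub_gen_smallest; exists C, t; split=> //.
by apply/seteqP; split=> G /=; rewrite -set_massE lte_fin.
Qed.

Lemma measurable_fun_set_mass (C : set T) : borel C ->
  measurable_fun setT (fun G : dprob R d => set_mass G C).
Proof.
move=> bC mD; apply: (measurability _ (measurable_realfun.RGenInftyO.measurableE R)) => //.
move=> _ [_ [t ->] <-]; rewrite setTI.
rewrite (_ : _ @^-1` _ = [set G : dprob R d | set_mass G C < t]).
  exact: measurable_set_mass_lt.
by apply/seteqP; split=> G /=; rewrite in_itv.
Qed.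

End countable_base.

(** * Bad orders as a measurable set with small sections *)

Section valid_draws.
Variables (R : realType) (d : nat).
Local Notation T := 'rV[R]_d.

Definition mass_at (p : T -> R) (x : option T) : R := oapp p 0 x.

(** The almost sure properties of an order on which the pathwise analysis rests. [None] counts as
    zero mass, so finite and infinite supports are treated alike. *)
Definition exhaustive_draws (p : T -> R) (t : nat -> option T) : Prop :=
  [/\ forall j k a, t j = Some a -> t k = Some a -> j = k,
      forall j a, t j = Some a -> 0 < p a &
      forall e, 0 < e -> exists m, 1 - e < \sum_(0 <= j < m) mass_at p (t j)].

Variables (dE : measure_display) (E : measurableType dE) (nu : probability E R).
Variable order : dprob R d -> E -> nat -> option T.
Hypothesis orderP : samples_without_replacement nu order.

Let ord (z : dprob R d * E) := order z.1 z.2.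

Let drawn j (C : set T) : set (dprob R d * E) := drawn_in ord j C.

Let m_drawn j C : borel C -> measurable (drawn j C).
Proof. exact: orderP.1. Qed.

Let m_fst (A : set (dprob R d)) : measurable A -> measurable [set z : dprob R d * E | A z.1].
Proof. by move=> mA; rewrite -[X in measurable X]setTI; exact: measurable_fst. Qed.

Lemma measurable_mass_at j :
  measurable_fun setT (fun z : dprob R d * E => mass_at z.1 (ord z j)).
Proof.
move=> mD; apply: (measurability _ (measurable_realfun.RGenInftyO.measurableE R)) => //.
move=> _ [_ [t ->] <-]; rewrite setTI.
(* A missing atom has value 0, below [t] only when [t] is positive; a drawn atom is tested against
   the countable base. *)
have -> : (fun z : dprob R d * E => mass_at z.1 (ord z j)) @^-1` [set` `]-oo, t[%R] =
    ((if 0 < t then setT else set0) `&` ~` drawn j setT) `|`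
    \bigcup_i (drawn j (rat_ball i) `&` [set z | set_mass z.1 (rat_ball i) < t]).
  apply/seteqP; split=> -[G u] /=; rewrite in_itv /drawn /drawn_in /ord /=.
    case oj: (order G u j) => [a|] /= at_; last first.
      by left; rewrite at_; split=> // -[].
    right; have [rho r0 rt] := set_mass_eball_lt at_.
    have [i ia ir] := rat_ball_small a r0.
    exists i => //; split; first by exists a.
    by apply: le_lt_trans rt; exact: le_set_mass.
  move=> [[t0 n]|[i _ [[a ia ->] it]]] /=.
    case oj: (order G u j) n => [a|] n /=; first by exfalso; apply: n; exists a.
    by move: t0; case: ifP.
  apply: le_lt_trans it; rewrite -[leLHS](big_seq1 +%R a G).
  by apply: sum_le_set_mass => // x /=; rewrite inE => /eqP ->.
apply: measurableU.
  apply: measurableI; first by case: ifP.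
  by apply: measurableC; apply: m_drawn; exact: borelT.
apply: countable_bigcupT_measurable => [|i]; first exact: countableP.
apply: measurableI; first by apply: m_drawn; exact: borel_rat_ball.
by have := m_fst (@measurable_set_mass_lt _ _ _ t (borel_rat_ball i)).
Qed.

Let same j k : set (dprob R d * E) :=
  [set z | exists a, ord z j = Some a /\ ord z k = Some a].

(** Two drawn atoms differ exactly when some rational ball contains the first and misses the
    second. *)
Let measurable_same j k : measurable (same j k).
Proof.
have -> : same j k = drawn j setT `&` drawn k setT `&`
    ~` \bigcup_i (drawn j (rat_ball i) `&` ~` drawn k (rat_ball i)).
  apply/seteqP; split=> z.
    move=> [a [ja ka]]; split; first by split; exists a.
    move=> [i _ [[b ib]]]; rewrite ja => -[ab]; subst b.
    by apply; exists a.
  move=> [[[a _ ja] [b _ kb]] n]; exists a; split=> //; rewrite kb; congr Some.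
  apply/eqP/negPn/negP => ba; apply: n.
  have [rho r0 /(_ b (mem_head _ _) ba) rb] := finite_isolated [:: b] a.
  have [i ia ir] := rat_ball_small a r0.
  exists i => //; split; first by exists a.
  move=> [c ic]; rewrite kb => -[bc]; subst c.
  by have := ir _ ic; rewrite /eball /= ltNge rb.
apply: measurableI.
  by apply: measurableI; apply: m_drawn; exact: borelT.
apply: measurableC; apply: countable_bigcupT_measurable => [|i]; first exact: countableP.
apply: measurableI; last apply: measurableC; apply: m_drawn; exact: borel_rat_ball.
Qed.

Let massless j : set (dprob R d * E) :=
  drawn j setT `&` [set z : dprob R d * E | mass_at z.1 (ord z j) <= 0].

Let measurable_massless j : measurable (massless j).
Proof.
apply: measurableI; first by apply: m_drawn; exact: borelT.
rewrite (_ : [set z | _] = setT `&`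
    (fun z : dprob R d * E => mass_at z.1 (ord z j)) @^-1` [set` `]-oo, 0]%R]).
  by apply: measurable_mass_at => //; exact: measurable_itv.
by rewrite setTI; apply/seteqP; split=> z /=; rewrite in_itv.
Qed.

Let unexhausted k : set (dprob R d * E) :=
  \bigcap_m [set z : dprob R d * E | \sum_(0 <= j < m) mass_at z.1 (ord z j) <= 1 - k.+1%:R^-1].

Let measurable_unexhausted k : measurable (unexhausted k).
Proof.
apply: bigcapT_measurable => m.
have mS : measurable_fun setT (fun z : dprob R d * E => \sum_(0 <= j < m) mass_at z.1 (ord z j)).
  by apply: measurable_sum => j; exact: measurable_mass_at.
rewrite (_ : [set z | _] = setT `&` (fun z : dprob R d * E => \sum_(0 <= j < m) mass_at z.1 (ord z j)) @^-1`
    [set` `]-oo, 1 - k.+1%:R^-1]%R]).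
  by apply: mS => //; exact: measurable_itv.
by rewrite setTI; apply/seteqP; split=> z /=; rewrite in_itv.
Qed.

(** It contains every pair whose order fails [exhaustive_draws], and is built by countable
    operations from events about single draws, so that it is jointly measurable. *)
Definition defective : set (dprob R d * E) :=
  (\bigcup_j \bigcup_(k in [set k | (j < k)%N]) same j k) `|`
  (\bigcup_j massless j) `|` (\bigcup_k unexhausted k).

Lemma measurable_defective : measurable defective.
Proof.
apply: measurableU; last exact: bigcupT_measurable.
apply: measurableU; last exact: bigcupT_measurable.
by apply: bigcupT_measurable => j; exact: bigcup_measurable.
Qed.

Lemma defectiveP z : ~ defective z -> exhaustive_draws z.1 (ord z).
Proof.
move=> nz; have h1 j k a : (j < k)%N -> ord z j = Some a -> ord z k = Some a -> False.
  by move=> jk ja ka; apply: nz; left; left; exists j => //; exists k => //; exists a.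
split.
- move=> j k a ja ka; have [jk|kj|//] := ltngtP j k.
    by case: (h1 j k a).
  by case: (h1 k j a).
- move=> j a ja; rewrite ltNge; apply/negP => a0; apply: nz; left; right.
  by exists j => //; split; [exists a | rewrite /= ja].
- move=> e e0; have [k] := ltr_add_invr e0; rewrite add0r => ke.
  apply: contrapT => ne; apply: nz; right; exists k => // m _ /=.
  rewrite leNgt; apply/negP => mk; apply: ne; exists m.
  by apply: lt_trans mk; rewrite ltrD2l ltrN2.
Qed.

(** Repeated and massless draws are excluded on histories of positive probability. For exhaustion,
    finitely many atoms carry almost all the mass, and each of them is almost surely drawn. *)
Lemma defective_null G : nu (xsection defective G) = 0%E.
Proof.
have mx (A : set (dprob R d * E)) : measurable A -> measurable (xsection A G).
  exact: measurable_xsection.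
have om j B : borel B -> measurable [set u | exists2 a, B a & order G u j = Some a].
  move=> bB; have := mx _ (orderP.1 j B bB); congr measurable.
  by apply/seteqP; split=> u; rewrite /xsection /= inE.
have ol := orderP.2 G.
have xE (A : set (dprob R d * E)) : xsection A G = [set u | A (G, u)].
  by apply/seteqP; split=> u; rewrite /xsection /= inE.
have pn A : measurable A -> prob nu A = 0 -> nu.-negligible A.
  by move=> mA p0; apply/(negligibleP nu mA); apply: etrans (esym (probE nu mA)) _; rewrite p0.
apply: measure_negligible; first exact: mx measurable_defective.
have xU (A B : set (dprob R d * E)) :
  xsection (A `|` B) G = xsection A G `|` xsection B G by rewrite !xE.
rewrite /defective !xU; apply: negligibleU; first apply: negligibleU.
- rewrite xsection_bigcup; apply: negligible_bigcup => j.
  rewrite bigcup_mkcond xsection_bigcup; apply: negligible_bigcup => k.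
  case: ifPn => [|_]; last by rewrite xsection0; exact: negligible_set0.
  rewrite inE /= => jk; apply: pn; first exact: mx.
  apply: (prob_null om ol (m := k.+1)); first exact: mx.
  move=> s sk /draws_prob_valid[us _]; apply/seteqP; split=> u //.
  rewrite xE => -[[a [/= ja ka]]]; rewrite /agree /= sk => su.
  rewrite /ord /= in ja ka.
  have jk' : j = k.
    apply: (pmap_id_uniq_nth (a := a) us); rewrite -su nth_mkseq//.
    by rewrite ltnS ltnW.
  by move: jk; rewrite jk' ltnn.
- rewrite xsection_bigcup; apply: negligible_bigcup => j.
  apply: pn; first exact: mx.
  apply: (prob_null om ol (m := j.+1)); first exact: mx.
  move=> s sj /draws_prob_valid[_ Gs]; apply/seteqP; split=> u //.
  rewrite xE => -[[[a _ ja]] /=]; rewrite /ord /= in ja *.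
  rewrite ja /= leNgt /agree /= sj => /negP aG su; apply: aG; apply: Gs.
  rewrite mem_pmap map_id -su -ja; apply/mapP; exists j => //.
  by rewrite mem_iota ltnSn.
- rewrite xsection_bigcup; apply: negligible_bigcup => k.
  have [|l [ul _]] := @set_mass_approx _ _ G setT k.+1%:R^-1; first by rewrite invr_gt0.
  rewrite set_massT => lG.
  pose never a := [set u | 0 < G a /\ forall j, order G u j != Some a].
  apply: (@negligibleS _ _ _ _ (\bigcup_(a in [set` l]) never a)).
    move=> u; rewrite xE => /= un; apply: contrapT => nev.
    have /choice[f fP] : forall a, exists j, a \in l -> 0 < G a -> order G u j = Some a.
      move=> a; have [al|] := boolP (a \in l); last by exists 0%N.
      have [Ga|] := boolP (0 < G a); last by exists 0%N.
      apply: contrapT => h; apply: nev; exists a => //; split=> // j.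
      by apply/eqP => ja; apply: h; exists j.
    (* By this time all atoms of positive mass in [l] have been drawn, so the collected mass already
       exceeds [1 - 1 / (k + 1)]. *)
    have := un (\max_(a <- l) (f a).+1) I; rewrite /= leNgt => /negP; apply.
    apply: lt_le_trans lG _.
    rewrite (bigID (fun a => 0 < G a)) /= [X in _ + X]big1 ?addr0; last first.
      by move=> a; rewrite -leNgt => Ga; apply/eqP; rewrite eq_le Ga mass_ge0.
    rewrite -big_filter; set l' := [seq a <- l | 0 < G a].
    have fl' a : a \in l' -> order G u (f a) = Some a.
      by rewrite mem_filter => /andP[Ga al]; exact: fP.
    rewrite (eq_big_seq (fun a => mass_at G (order G u (f a)))); last first.
      by move=> a /fl' ->.
    rewrite -(big_map f xpredT (fun j => mass_at G (order G u j))).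
    apply: ler_sum_sub; rewrite ?iota_uniq//.
    + by move=> j; case: (order G u j) => //= a; exact: mass_ge0.
    + rewrite map_inj_in_uniq ?filter_uniq// => a b /fl' fa /fl' fb fab.
      by move: fa; rewrite fab fb => -[].
    + move=> _ /mapP[a al' ->]; rewrite mem_index_iota /=.
      by apply: leq_bigmax_seq => //; move: al'; rewrite mem_filter => /andP[].
  rewrite bigcup_seq; apply: big_ind => [|A B|a _].
  + exact: negligible_set0.
  + exact: negligibleU.
  + have [Ga|Ga] := boolP (0 < G a); last first.
      suff -> : never a = set0 by exact: negligible_set0.
      by apply/seteqP; split=> v // [/(negP Ga)].
    have -> : never a = [set u | forall j, order G u j != Some a].
      by apply/seteqP; split=> v; [case|split].
    apply: pn (prob_never_drawn om ol Ga).
    rewrite (_ : [set u | _] = \bigcap_j ~` [set u | order G u j = Some a]).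
      apply: bigcapT_measurable => j; apply: measurableC.
      exact: (measurable_draw om).
    apply/seteqP; split=> v /= h j; first by move=> _; exact/eqP.
    by apply/eqP; exact: h.
Qed.

(** The mass constraints belong to the event, so that its sections obey one bound [b / g] for all
    measures: where the constraints fail, the section is empty. *)
Definition early_draw (g b : R) (C1 C2 : set T) : set (dprob R d * E) :=
  [set z | g <= set_mass z.1 C1 /\ set_mass z.1 C2 <= b] `&`
  \bigcup_j first_in ord (C1 `|` C2) j C2.

Lemma measurable_early_draw g b C1 C2 : borel C1 -> borel C2 ->
  measurable (early_draw g b C1 C2).
Proof.
move=> b1 b2; apply: measurableI; last first.
  apply: bigcupT_measurable => j.
  by apply: (measurable_first_in orderP.1) => //; exact: borelU.
have m1 := measurable_fun_set_mass b1 measurableT (measurable_itv `[g, +oo[%R).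
have m2 := measurable_fun_set_mass b2 measurableT (measurable_itv `]-oo, b]%R).
have := m_fst (measurableI _ _ m1 m2); congr measurable.
apply/seteqP; split=> z /=; rewrite !in_itv /= !andbT.
  by move=> [[_ ?] [_ ?]].
by move=> [].
Qed.

Lemma prob_early_draw g b C1 C2 G : borel C1 -> borel C2 -> C1 `&` C2 = set0 ->
  0 < g -> 0 <= b -> (nu (xsection (early_draw g b C1 C2) G) <= (b / g)%:E)%E.
Proof.
move=> b1 b2 C12 g0 b0.
have om j B : borel B -> measurable [set u | exists2 a, B a & order G u j = Some a].
  move=> bB; have := measurable_xsection G (orderP.1 j B bB); congr measurable.
  by apply/seteqP; split=> u; rewrite /xsection /= inE.
have [h|h] := pselect (g <= set_mass G C1 /\ set_mass G C2 <= b); last first.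
  rewrite (_ : xsection _ _ = set0) ?measure0 ?lee_fin ?divr_ge0 ?(ltW g0)//.
  by apply/seteqP; split=> u //; rewrite /xsection /= inE => -[/h].
have -> : xsection (early_draw g b C1 C2) G = \bigcup_j first_in (order G) (C1 `|` C2) j C2.
  by apply/seteqP; split=> u; rewrite /xsection /= inE; [case|split].
have mU : measurable (\bigcup_j first_in (order G) (C1 `|` C2) j C2).
  by apply: bigcupT_measurable => j; apply: (measurable_first_in om) => //; exact: borelU.
apply: (@le_trans _ _ (prob nu (\bigcup_j first_in (order G) (C1 `|` C2) j C2))%:E).
  by rewrite probE.
rewrite lee_fin; case: h => gC Cb; have G1 := lt_le_trans g0 gC.
apply: le_trans (prob_first_in_le om (orderP.2 G) b1 b2 C12 G1) _.
by rewrite ler_pM ?set_mass_ge0// ?invr_ge0 ?set_mass_ge0// lef_pV2 ?posrE.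
Qed.

End valid_draws.

(** [N] may be nonmeasurable: each countable cover of [N] lifts to a cover by cylinders of the same
    total measure, since [m2] is a probability. The part [Z] is handled by integrating its
    sections. *)
Lemma mu_ext_product_le (R : realType) (d1 d2 : measure_display)
    (T1 : measurableType d1) (T2 : measurableType d2)
    (m1 : {measure set T1 -> \bar R}) (m2 : probability T2 R)
    (N : set T1) (Z A : set (T1 * T2)) (e : R) :
  m1 setT = 1%E -> measurable Z ->
  (forall x, (m2 (xsection Z x) <= e%:E)%E) ->
  A `<=` [set z | N z.1] `|` Z ->
  (mu_ext (m1 \x m2) A <= mu_ext m1 N + e%:E)%E.
Proof.
move=> m1T mZ Ze ANZ; apply: (le_trans (le_mu_ext _ ANZ)).
apply: (le_trans (outer_measureU2 (mu_ext (m1 \x m2)%E) _ _)).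
apply: leeD; last first.
  rewrite [leLHS](_ : _ = (m1 \x m2)%E Z); last exact: measurable_mu_extE.
  rewrite /product_measure1.
  apply: (@le_trans _ _ (\int[m1]_x (cst e%:E x))%E).
    apply: ge0_le_integral => //; first exact: measurable_fun_xsection.
    by move=> x _; apply: le_trans (Ze x).
  by rewrite integral_cst// m1T mule1.
apply: le_ereal_inf_tmp => _ [F [mF NF] <-].
apply: ereal_inf_lbound; exists (fun k => F k `*` setT).
  split=> [k|z /= /NF[k _ Fk]]; last by exists k.
  exact: measurableX.
apply: eq_eseriesr => k _.
rewrite [LHS](_ : _ = (m1 (F k) * m2 setT)%E); last exact: product_measure1E.
by rewrite probability_setT mule1.
Qed.

(** * Stage 1 *)

Lemma map_set_nth (A B : Type) (f : A -> B) x s i y :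
  map f (set_nth x s i y) = set_nth (f x) (map f s) i (f y).
Proof.
elim: s i => [|z s ih] [|i] //=; last by rewrite ih.
by elim: i => //= i [->].
Qed.

Lemma set_nth_id (A : Type) (x : A) s i : (i < size s)%N ->
  set_nth x s i (nth x s i) = s.
Proof. by elim: s i => [|z s ih] [|i] //= /ih ->. Qed.

Lemma set_nth_size (A : Type) (x : A) s y : set_nth x s (size s) y = rcons s y.
Proof. by elim: s => //= z s ->. Qed.

(** * Mass collected along an exhaustive order *)

Section draws.
Variables (R : realType) (d : nat) (G : dprob R d) (t : nat -> option 'rV[R]_d).
Local Notation T := 'rV[R]_d.
Hypothesis tG : exhaustive_draws G t.

Definition mass_in (C : set T) (x : option T) : R :=
  if x is Some a then if `[< C a >] then G a else 0 else 0.

Lemma sum_mass_inE C m : \sum_(0 <= j < m) mass_in C (t j) =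
  \sum_(a <- [seq a <- pmap t (iota 0 m) | `[< C a >]]) G a.
Proof.
rewrite big_filter /index_iota subn0; elim: (iota 0 m) => [|j s ih].
  by rewrite !big_nil.
by rewrite big_cons ih /=; case: (t j) => [a|] /=; rewrite ?add0r// big_cons; case: ifP; rewrite ?add0r.
Qed.

Lemma sum_mass_in_le C m : \sum_(0 <= j < m) mass_in C (t j) <= set_mass G C.
Proof.
rewrite sum_mass_inE; apply: sum_le_set_mass; last first.
  by move=> x /=; rewrite mem_filter => /andP[/asboolP].
apply: filter_uniq.
elim: (iota 0 m) (iota_uniq 0 m) => //= j s ih /andP[js us].
case tj : (t j) => [a|] /=; last exact: ih.
rewrite ih// andbT mem_pmap; apply/negP => /mapP[k ks tk].
case: tG => h _ _; move: js; rewrite (h j k a)// ?ks//; by rewrite -tk.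
Qed.

(** The collected mass is bounded above both on [C] and on its complement, while the total tends to
    1; hence both bounds are attained in the limit. *)
Lemma sum_mass_in_cvg C :
  \sum_(0 <= j < m) mass_in C (t j) @[m --> \oo] --> set_mass G C.
Proof.
apply/cvgrPdist_le => e e0; case: tG => _ _ /(_ e e0)[m0 em].
exists m0 => // m /= m0m; rewrite ger0_norm ?subr_ge0 ?sum_mass_in_le//.
have : set_mass G C + set_mass G (~` C) = 1.
  by rewrite -set_massD ?setICr// setUv set_massT.
have := sum_mass_in_le (~` C) m.
have : \sum_(0 <= j < m) mass_at G (t j) =
    \sum_(0 <= j < m) mass_in C (t j) + \sum_(0 <= j < m) mass_in (~` C) (t j).
  rewrite -big_split /=; apply: eq_bigr => j _; case: (t j) => [a|] /=; last by rewrite addr0.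
  have [Ca|nCa] := pselect (C a).
    by rewrite asboolT// asboolF ?addr0.
  by rewrite asboolF// asboolT// add0r.
have : \sum_(0 <= j < m0) mass_at G (t j) <= \sum_(0 <= j < m) mass_at G (t j).
  rewrite [leRHS](big_cat_nat (n := m0))//= lerDl sumr_ge0// => j _.
  by case: (t j) => //= a; exact: mass_ge0.
by move: em; lra.
Qed.

Lemma mass_drawn a : 0 < G a -> exists j, t j = Some a.
Proof.
move=> Ga; apply: contrapT => h.
have := @sum_mass_in_cvg [set` [:: a]]; rewrite set_mass_seq// big_seq1.
rewrite (_ : (fun m => _) = cst 0).
  move=> /(cvg_unique (@Rhausdorff R) (cvg_cst 0)) a0.
  by move: Ga; rewrite -a0 ltxx.
apply/funext => m; rewrite big1// => j _; rewrite /mass_in.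
case tj : (t j) => [b|] //; rewrite asboolF//= inE => /eqP ba.
by apply: h; exists j; rewrite tj ba.
Qed.

End draws.

(** * Surviving keys and their cells *)

Section merging.
Variables (R : realType) (d : nat) (w : R).
Local Notation T := 'rV[R]_d.
Implicit Types (K : seq T) (p : T -> R) (s : seq (T * R)) (t : nat -> option T).
Hypothesis w0 : 0 < w.

Definition near_key (y b : T) := enorm (b - y) <= w.

(* The key that absorbs [y] in stage 1, or [y] itself if no key is within [w]. *)
Definition center K y : T := nth y K (find (near_key y) K).

Lemma near_key_refl y : near_key y y.
Proof. by rewrite /near_key subrr enorm0 ltW. Qed.

Lemma center_mem K y : has (near_key y) K -> center K y \in K.
Proof. by move=> h; rewrite mem_nth// -has_find. Qed.

Lemma center_near K y : has (near_key y) K -> enorm (center K y - y) <= w.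
Proof. by move=> h; exact: (nth_find y h). Qed.

Lemma center_cat K1 a K2 y : ~~ has (near_key y) K1 -> near_key y a ->
  center (K1 ++ a :: K2) y = a.
Proof.
move=> K1y ya; rewrite /center find_cat (negbTE K1y) /= ya addn0.
by rewrite nth_cat ltnn subnn.
Qed.

Definition separated K := pairwise (fun x y => w < enorm (x - y)) K.

Lemma separated_uniq K : separated K -> uniq K.
Proof.
apply: pairwise_uniq => x; by rewrite subrr enorm0 lt_gtF.
Qed.

(** The default value [y] of [center] causes no confusion: a [y] with no key nearby is not itself a
    key, since a key is near itself. *)
Lemma find_center K y i : separated K -> (i < size K)%N ->
  (find (near_key y) K == i) = (center K y == nth y K i).
Proof.
move=> sK iK; have uK := separated_uniq sK.
have [h|h] := boolP (has (near_key y) K).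
  by rewrite /center nth_uniq// -has_find.
rewrite /center hasNfind// nth_default// gtn_eqF//; apply/esym/negbTE.
apply: contra h => /eqP yi; apply/hasP; exists (nth y K i); first exact: mem_nth.
by rewrite -yi near_key_refl.
Qed.

Definition keys p t m : seq T := map fst (merge_run p w t m).

Lemma merge_runS p t m :
  merge_run p w t m.+1 = merge_step p w (merge_run p w t m) (t m).
Proof. by rewrite /merge_run mkseqS foldl_rcons. Qed.

Lemma find_keys p t m a :
  find (fun b => enorm (b.1 - a) <= w) (merge_run p w t m) = find (near_key a) (keys p t m).
Proof. by rewrite /keys find_map. Qed.

Lemma keysS p t m : keys p t m.+1 =
  if t m is Some a then
    if has (near_key a) (keys p t m) then keys p t m else rcons (keys p t m) a
  else keys p t m.
Proof.
rewrite {1}/keys merge_runS /merge_step; case: (t m) => // a.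
rewrite find_keys map_set_nth /=; set i := find _ _.
have ->: (nth (a, 0) (merge_run p w t m) i).1 = nth a (keys p t m) i.
  have [im|im] := ltnP i (size (keys p t m)); last first.
    by rewrite !nth_default// -(size_map fst).
  by rewrite (nth_map (a, 0))// -(size_map fst).
have [h|h] := boolP (has _ _); first by rewrite set_nth_id// -has_find.
by rewrite /i hasNfind// nth_default// set_nth_size.
Qed.

Lemma keys_prefix p t m k : exists K, keys p t (m + k) = keys p t m ++ K.
Proof.
elim: k => [|k [K ih]]; first by exists [::]; rewrite addn0 cats0.
rewrite addnS keysS ih; case: (t _) => [a|]; last by exists K.
by case: ifP => _; [exists K|exists (rcons K a); rewrite rcons_cat].
Qed.

Lemma keys_drawn p t m x : x \in keys p t m -> exists2 i, (i < m)%N & t i = Some x.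
Proof.
elim: m => // m ih; rewrite keysS.
have h : x \in keys p t m -> exists2 i, (i < m.+1)%N & t i = Some x.
  by move=> /ih[i im]; exists i => //; rewrite ltnS ltnW.
case tm : (t m) => [a|] //; case: ifP => // _.
by rewrite mem_rcons inE => /predU1P[->|//]; exists m.
Qed.

Lemma separated_keys p t m : separated (keys p t m).
Proof.
elim: m => // m ih; rewrite keysS; case: (t m) => // a; case: ifPn => // h.
rewrite /separated pairwise_rcons -/(separated _) ih andbT.
by move: h; rewrite -all_predC; apply: sub_all => b /=; rewrite -ltNge.
Qed.

Lemma has_near_keys p t m j a : (j < m)%N -> t j = Some a -> has (near_key a) (keys p t m).
Proof.
move=> jm tj; rewrite -(subnKC jm); have [K ->] := keys_prefix p t j.+1 (m - j.+1).
rewrite has_cat keysS tj; case: ifPn => [->//|h].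
by rewrite has_rcons near_key_refl.
Qed.

Lemma find_near_cat K1 K2 a : has (near_key a) K1 ->
  find (near_key a) (K1 ++ K2) = find (near_key a) K1.
Proof. by move=> h; rewrite find_cat h. Qed.

(** Every atom drawn so far has a near key already, so appending [K] does not change which key
    absorbs it. Leaving [K] arbitrary lets the induction survive the growth of the key list and
    later allows the final list to be used. *)
Lemma merge_run_weight (G : dprob R d) t m K i :
  (nth (0, 0) (merge_run G w t m) i).2 =
  \sum_(0 <= j < m) mass_in G [set a | find (near_key a) (keys G t m ++ K) = i] (t j).
Proof.
elim: m K => [|m ih] K in i *; first by rewrite big_geq//= nth_nil.
rewrite merge_runS big_nat_recr//= keysS.
case tm : (t m) => [a|] /=; last by rewrite addr0; exact: ih.
set K' := if has _ _ then _ else _.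
have [K2 K2E] : exists K2, K' ++ K = keys G t m ++ K2.
  rewrite /K'; case: ifP => _; first by exists K.
  by exists (a :: K); rewrite cat_rcons.
have fa : find (near_key a) (K' ++ K) = find (near_key a) (keys G t m).
  rewrite /K'; case: ifPn => h; first exact: find_near_cat.
  by rewrite cat_rcons find_cat (negbTE h) /= near_key_refl addn0 hasNfind.
have nthE (s : seq (T * R)) j x : (nth (x, 0) s j).2 = (nth (0, 0) s j).2.
  have [js|js] := ltnP j (size s); last by rewrite !nth_default.
  by rewrite (set_nth_default (x, 0)).
rewrite -(nthE _ _ a) nth_set_nth /= find_keys fa K2E [i == _]eq_sym.
have [<-|/eqP fi] := eqVneq (find (near_key a) (keys G t m)) i.
  by rewrite asboolT//= nthE (ih K2).
by rewrite asboolF//= nthE (ih K2) addr0.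
Qed.

(** Keys are more than [w] apart, so a ball of radius [w / 2] of a finite net holds at most one of
    them. The number of keys is bounded, and as keys are only appended, a stage with the largest
    number is final. *)
Lemma keys_eventually_const p t (Theta : set T) : compact Theta ->
  (forall j a, t j = Some a -> Theta a) ->
  exists m0, forall m, (m0 <= m)%N -> keys p t m = keys p t m0.
Proof.
move=> cT tT; have w2 : 0 < w / 2 by rewrite divr_gt0.
have [l lP] := finite_net cT w2.
have /choice[f fP] : forall x, exists c, Theta x -> c \in l /\ eball c (w / 2) x.
  move=> x; have [/lP[c cl xc]|nx] := pselect (Theta x); first by exists c.
  by exists 0 => /nx.
have size_keys m : (size (keys p t m) <= size l)%N.
  have Tk x : x \in keys p t m -> Theta x by move=> /keys_drawn[j _ /tT].
  rewrite -(size_map f); apply: uniq_leq_size; last first.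
    by move=> _ /mapP[x /Tk Tx ->]; case: (fP x Tx).
  have := separated_keys p t m; rewrite /separated => sK.
  suff : pairwise (fun x y => x != y) [seq f x | x <- keys p t m] by rewrite -uniq_pairwise.
  rewrite pairwise_map; apply: (sub_in_pairwise _ (allss _) sK) => x y /Tk Tx /Tk Ty.
  apply: contraTneq => /= fxy; rewrite -leNgt.
  have [_] := fP x Tx; have [_] := fP y Ty; rewrite fxy /eball /= enormB => h1 h2.
  by have := ler_enorm_dist x (f y) y; lra.
pose P n := `[< exists m, size (keys p t m) = n >].
have [||n /asboolP[m0 m0n] nmax] := @ex_maxnP P (size l).
- by exists (size (keys p t 0)); apply/asboolP; exists 0%N.
- by move=> n /asboolP[m <-].
exists m0 => m m0m; rewrite -(subnKC m0m); have [K KE] := keys_prefix p t m0 (m - m0).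
have := nmax (size (keys p t (m0 + (m - m0)))) (asboolT (ex_intro _ _ erefl)).
rewrite KE size_cat m0n; case: K {KE} => [|b K] /=; first by rewrite cats0.
by rewrite addnS ltnNge leq_addr.
Qed.

(** The limit weight of a key is the mass of its cell. The last clause locates a key: an atom with
    no near predecessor is kept, and every key ahead of it was drawn earlier, which decides who
    absorbs the points around it. *)
Lemma mergedP (Theta : set T) (G : dprob R d) t : compact Theta -> gbar Theta G ->
  exhaustive_draws G t -> exists K,
  [/\ separated K,
      merged G w t = [seq (x, set_mass G [set y | center K y = x]) | x <- K],
      forall a, 0 < G a -> has (near_key a) K &
      forall j a, t j = Some a ->
        (forall i b, (i < j)%N -> t i = Some b -> ~~ near_key a b) ->
        exists K1 K2, K = K1 ++ a :: K2 /\
          forall x, x \in K1 -> exists2 i, (i < j)%N & t i = Some x].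
Proof.
move=> cT GT tG; have tT j a : t j = Some a -> Theta a.
  case: tG => _ h _ /h Ga; apply: contrapT => /GT Ga0.
  by move: Ga; rewrite Ga0 ltxx.
have [m0 m0K] := keys_eventually_const G cT tT.
set K := keys G t m0 in m0K; have sK : separated K by exact: separated_keys.
have uK := separated_uniq sK.
have keysm j : exists K2, K = keys G t j ++ K2.
  have [jm|/ltnW mj] := leqP j m0.
    by have [K2] := keys_prefix G t j (m0 - j); rewrite subnKC// => K2E; exists K2.
  by exists [::]; rewrite cats0 m0K.
exists K; split => //.
- pose L := [seq (x, set_mass G [set y | center K y = x]) | x <- K].
  have LK : map fst L = K by rewrite -map_comp map_id.
  have cvL i : (i < size K)%N -> (nth (0, 0) (merge_run G w t m) i).2 @[m --> \oo]
      --> (nth (0, 0) L i).2.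
    move=> iK; rewrite (nth_map 0)//=.
    have -> : [set y | center K y = nth 0 K i] = [set y | find (near_key y) K = i].
      apply/seteqP; split=> y /=.
        move=> ci; apply/eqP; rewrite find_center//; apply/eqP; rewrite ci.
        exact: set_nth_default.
      by move=> /eqP; rewrite find_center// => /eqP ->; exact: set_nth_default.
    apply: cvg_trans (sum_mass_in_cvg (C := [set y | find (near_key y) K = i]) tG).
    apply: near_eq_cvg; exists m0 => // m /= m0m.
    by rewrite (merge_run_weight G t m [::]) cats0 m0K.
  have : [set l | (\forall m \near \oo, map fst (merge_run G w t m) = map fst l) /\
    (forall i, (i < size l)%N -> (nth (0, 0) (merge_run G w t m) i).2 @[m --> \oo]
         --> (nth (0, 0) l i).2)] L.
    split; first by exists m0 => // m /= m0m; rewrite LK; exact: m0K.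
    by move=> i; rewrite size_map; exact: cvL.
  (* [L] shows that a limit exists, so [xget] returns some limit; the keys and the uniqueness of
     limits identify it with [L]. *)
  move=> /(ex_intro _ L)/(xgetPex [::])[]; rewrite -/(merged G w t).
  move: (merged G w t) => M MK Mcv.
  have {}MK : map fst M = K.
    have [m1 _ /(_ (maxn m0 m1))] := MK; rewrite /= leq_maxr => /(_ isT) <-.
    by apply: m0K; exact: leq_maxl.
  have sMK : size M = size K by rewrite -MK size_map.
  have sM : size M = size L by rewrite sMK [RHS]size_map.
  apply: (@eq_from_nth _ (0, 0)) => // i iM; apply/eqP; rewrite -pair_eqE /=.
  apply/andP; split; apply/eqP.
    by rewrite -!(nth_map _ 0 fst) ?MK ?LK// -sM.
  apply: (cvg_unique (@Rhausdorff R) (Mcv i iM)); apply: cvL.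
  by rewrite -sMK.
- move=> a /(mass_drawn tG)[j ja]; have [K2 ->] := keysm j.+1.
  by rewrite has_cat (has_near_keys G (ltnSn j) ja).
- move=> j a ja far; have [K2] := keysm j.+1; rewrite keysS ja ifF; last first.
    apply/negbTE/hasPn => x /keys_drawn[i ij ix]; exact: (far i x).
  rewrite cat_rcons => KE; exists (keys G t j), K2; split=> // x; exact: keys_drawn.
Qed.

End merging.

(** * Stage 2 *)

(** Strict domination makes the split independent of how sorting orders ties. *)
Lemma sorted_filter_split (A : eqType) (e : rel A) (P : pred A) (s : seq A) :
  transitive e -> sorted e s ->
  (forall x y, x \in s -> y \in s -> P y -> ~~ P x -> ~~ e x y) ->
  s = [seq x <- s | P x] ++ [seq x <- s | ~~ P x].
Proof.
move=> et; elim: s => //= x s ih; rewrite path_sortedE// => /andP[xs es] eP.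
have sE : s = [seq x <- s | P x] ++ [seq x <- s | ~~ P x].
  by apply: ih => // y z ys zs; apply: eP; rewrite inE (ys, zs) orbT.
have [Px|Px] := boolP (P x); first by rewrite /= -sE.
have nP : all (predC P) s.
  apply/allP => y ys; apply: contraTN (allP xs y ys) => Py.
  by apply: eP Py Px; rewrite ?mem_head// inE ys orbT.
have /all_filterP -> := nP.
suff -> : [seq y <- s | P y] = [::] by [].
by apply/eqP; rewrite -[_ == _]negbK -has_filter -all_predC.
Qed.

Lemma seq_argmin (R : realType) (T : eqType) (f : T -> R) (l : seq T) : l != [::] ->
  exists2 y, y \in l & forall z, z \in l -> f y <= f z.
Proof.
elim: l => // y [|z l] ih _.
  by exists y; rewrite ?mem_head// => z; rewrite inE => /eqP ->.
have [//|v vl vP] := ih; have [yv|vy] := lerP (f y) (f v).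
  exists y; rewrite ?mem_head// => u; rewrite inE => /predU1P[->//|/vP].
  exact: le_trans.
exists v; first by rewrite inE vl orbT.
by move=> u; rewrite inE => /predU1P[->|/vP//]; exact: ltW.
Qed.

Lemma nearestP (R : realType) (d : nat) (A : seq ('rV[R]_d * R)) (x : 'rV[R]_d) :
  A != [::] -> nearest A x \in A /\
    forall y, y \in A -> enorm (x - (nearest A x).1) <= enorm (x - y.1).
Proof.
move=> A0; pose m (y : 'rV[R]_d * R) := all (fun y' : 'rV[R]_d * R => enorm (x - y.1) <= enorm (x - y'.1)) A.
have hm : has m A.
  have [y yA ymin] := seq_argmin (fun y => enorm (x - y.1)) A0.
  by apply/hasP; exists y => //; apply/allP.
split; first by rewrite mem_nth// -has_find.
by have /allP := nth_find (x, 0) hm.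
Qed.

(** * Stage 2 when some keys dominate the others *)

Section truncation.
Variables (R : realType) (d : nat) (r thr : R).
Local Notation T := 'rV[R]_d.
Local Notation wlist := (seq (T * R)).
Implicit Types (A L : wlist).

Definition close_to (x y : T * R) := x.2 * powR (enorm (x.1 - y.1)) r <= thr.

Let step A (x : T * R) := if has (close_to x) A then A else rcons A x.

Lemma truncatedE L : truncated r thr L = foldl step [::] [seq x <- L | thr < x.2].
Proof. by []. Qed.

Lemma foldl_keep A L : uniq (A ++ L) ->
  (forall x y, x \in L -> y \in A ++ L -> x != y -> ~~ close_to x y) ->
  foldl step A L = A ++ L.
Proof.
elim: L A => [|x L ih] A /=; first by rewrite cats0.
move=> u h; rewrite /step ifF.
  rewrite -/step ih; rewrite cat_rcons// => y z yL zA.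
  by apply: h => //; rewrite inE yL orbT.
apply/negbTE/hasPn => y yA; apply: h; rewrite ?mem_head//.
  by rewrite mem_cat yA.
apply: contraTneq u => ->; rewrite cat_uniq.
by rewrite [has _ _]/= yA /= andbF.
Qed.

Lemma foldl_drop A L : (forall x, x \in L -> has (close_to x) A) ->
  foldl step A L = A.
Proof.
elim: L => //= x L ih h; have -> : step A x = A by rewrite /step h ?mem_head.
by apply: ih => y yL; apply: h; rewrite inE yL orbT.
Qed.

(** [cs] stands for the keys meant to survive. The hypotheses below are later verified for the first
    draws near the atoms of [G0]. *)
Variables (K cs : seq T) (q : T -> R).
Hypothesis uK : uniq K.
Hypothesis ucs : uniq cs.
Hypothesis csK : {subset cs <= K}.
Hypothesis cs_heavy : forall a (x : T), a \in cs -> x \in K -> x \notin cs -> q x < q a.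
Hypothesis cs_thr : forall a, a \in cs -> thr < q a.
Hypothesis cs_apart : forall a b, a \in cs -> b \in cs -> a != b ->
  thr < q a * powR (enorm (a - b)) r.
Hypothesis close_cs : forall x : T, x \in K -> x \notin cs ->
  exists2 a, a \in cs & q x * powR (enorm (x - a)) r <= thr.

Let L := sort (fun x y : T * R => y.2 <= x.2) [seq (x, q x) | x <- K].
Let A := [seq x : T * R <- L | x.1 \in cs].
Let N := [seq x : T * R <- L | x.1 \notin cs].

Let uL : uniq L.
Proof. by rewrite sort_uniq map_inj_uniq// => x y []. Qed.

Let memL (x : T * R) : (x \in L) = (x.1 \in K) && (x.2 == q x.1).
Proof.
rewrite mem_sort; apply/mapP/andP => [[y yK ->]|[xK /eqP xq]]; first by rewrite /= eqxx.
by exists x.1 => //; rewrite -xq; case: x {xK xq}.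
Qed.

Let LE : L = A ++ N.
Proof.
apply: (sorted_filter_split (e := fun x y : T * R => y.2 <= x.2)).
- by move=> y x z yx zy; exact: le_trans zy yx.
- by apply: sort_sorted => x y; exact: le_total.
- move=> x y; rewrite !memL -ltNge => /andP[xK /eqP ->] /andP[_ /eqP ->] ycs xcs.
  exact: cs_heavy.
Qed.

Let memA (x : T * R) : (x \in A) = (x.1 \in cs) && (x.2 == q x.1).
Proof.
rewrite mem_filter memL; have [xcs|//] := boolP (x.1 \in cs).
by rewrite csK.
Qed.

Let memN (x : T * R) : (x \in N) = [&& x.1 \notin cs, x.1 \in K & x.2 == q x.1].
Proof. by rewrite mem_filter memL. Qed.

Let uA : uniq A. Proof. by rewrite filter_uniq. Qed.

Let uA1 : uniq (map fst A).
Proof.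
rewrite map_inj_in_uniq// => -[x1 x2] [y1 y2].
by rewrite !memA /= => /andP[_ /eqP ->] /andP[_ /eqP ->] ->.
Qed.

Lemma truncated_clusters : truncated r thr L = A.
Proof.
rewrite truncatedE LE filter_cat foldl_cat.
have /all_filterP -> : all (fun x => thr < x.2) A.
  by apply/allP => x; rewrite memA => /andP[/cs_thr ? /eqP ->].
rewrite (foldl_keep (A := [::]))//; last first.
  move=> [x1 x2] [y1 y2]; rewrite !memA /= => /andP[xcs /eqP ->] /andP[ycs /eqP ->] xy.
  rewrite /close_to /= -ltNge; apply: cs_apart => //.
  by apply: contraNneq xy => ->.
(* A light key may still exceed the threshold; it is then rejected because of a kept key close to
   it. *)
apply: foldl_drop => x; rewrite mem_filter memN => /and4P[_ xcs xK /eqP xq].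
have [a acs xa] := close_cs xK xcs.
apply/hasP; exists (a, q a); first by rewrite memA /= acs eqxx.
by rewrite /close_to xq.
Qed.

Let notin_clusters : [seq x <- L | x \notin A] = N.
Proof.
apply: eq_in_filter => x; rewrite memL memA => /andP[_ ->].
by rewrite andbT.
Qed.

Lemma size_truncate_merge :
  size (let B := truncated r thr L in final_merge B [seq x <- L | x \notin B]) = size cs.
Proof.
rewrite truncated_clusters /= notin_clusters size_map -(size_map fst); apply: perm_size; apply: uniq_perm => // x.
apply/mapP/idP => [[y yA ->]|xcs]; first by move: yA; rewrite memA => /andP[].
by exists (x, q x) => //; rewrite memA /= xcs eqxx.
Qed.

(** The effect of stage 2 as a map on keys, to be composed with [center]. *)
Definition relocate (x : T) := if x \in cs then x else (nearest A x).1.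

Hypothesis cs0 : cs != [::].

Lemma nearest_clusters (x : T) : nearest A x \in A /\
  forall a, a \in cs -> enorm (x - (nearest A x).1) <= enorm (x - a).
Proof.
have mA a : a \in cs -> (a, q a) \in A by move=> acs; rewrite memA /= acs eqxx.
have [|nA nmin] := @nearestP _ _ A x.
  by case: (cs) cs0 mA => // a l _ /(_ a (mem_head _ _)); apply: contraTneq => ->.
by split=> // a /mA; exact: nmin.
Qed.

Lemma relocateP (x : T) : relocate x \in cs /\
  (x \notin cs -> forall a, a \in cs -> enorm (x - relocate x) <= enorm (x - a)).
Proof.
have [nA nmin] := nearest_clusters x; rewrite /relocate.
by case: ifPn => // _; split=> //; move: nA; rewrite memA => /andP[].
Qed.

Lemma list_mass_truncate_merge (x : T) :
  list_mass (let B := truncated r thr L in final_merge B [seq x <- L | x \notin B]) x =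
  \sum_(y <- K | relocate y == x) q y.
Proof.
rewrite truncated_clusters /= notin_clusters.
have -> : \sum_(y <- K | relocate y == x) q y = \sum_(z <- L | relocate z.1 == x) z.2.
  by rewrite (perm_big [seq (y, q y) | y <- K]) ?perm_sort//= big_map.
rewrite LE big_cat /list_mass big_map big_split /=; congr (_ + _).
  rewrite big_seq_cond [RHS]big_seq_cond; apply: eq_bigl => z.
  by case: (boolP (z \in A)) => //; rewrite memA /relocate => /andP[-> _].
rewrite (exchange_big_dep predT)//= [RHS]big_mkcond /= big_seq [RHS]big_seq.
apply: eq_bigr => z; rewrite memN /relocate => /andP[/negbTE -> _].
have [nA _] := nearest_clusters z.1; case: ifPn => [/eqP nx|nx]; last first.
  rewrite big1// => y /andP[/eqP yx /eqP ny]; move: nx.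
  by rewrite ny yx eqxx.
rewrite big_mkcond (bigD1_seq _ nA uA) /= nx !eqxx big1 ?addr0// => y yn.
by rewrite [_ == y]eq_sym (negbTE yn) andbF.
Qed.

End truncation.

(** * Couplings *)

Section esum_algebra.
Local Open Scope ereal_scope.
Variables (R : realType).

Lemma esumZl (T : choiceType) (A : set T) (f : T -> \bar R) (c : R) :
  (0 <= c)%R -> (forall x, 0 <= f x) ->
  \esum_(x in A) (c%:E * f x) = c%:E * \esum_(x in A) f x.
Proof.
move=> c0 f0.
have le (e : R) (h : T -> \bar R) : (0 <= e)%R -> (forall x, 0 <= h x) ->
    \esum_(x in A) (e%:E * h x) <= e%:E * \esum_(x in A) h x.
  move=> e0 h0; apply: ge_ereal_sup => _ [X [finX XA] <-].
  rewrite -ge0_mule_fsumr// lee_wpmul2l ?lee_fin//.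
  by apply: ereal_sup_ubound; exists X.
have [->|c_neq0] := eqVneq c 0%R.
  by rewrite mul0e esum1// => x _; rewrite mul0e.
have c_gt0 : (0 < c)%R by rewrite lt_neqAle eq_sym c_neq0.
apply/eqP; rewrite eq_le le//= -lee_pdivlMl//.
(* The reverse inequality is the first one for [c^-1]. *)
have := @le c^-1%R (fun x => c%:E * f x); rewrite invr_ge0 => /(_ c0).
rewrite (_ : \esum_(x in A) (c^-1)%:E * (c%:E * f x) = \esum_(x in A) f x).
  by apply => x; rewrite mule_ge0// lee_fin.
by apply: eq_esum => x _; rewrite muleA -EFinM mulVf// mul1e.
Qed.

Lemma esum_pair (T1 T2 : choiceType) (f : T1 * T2 -> \bar R) :
  (forall z, 0 <= f z) ->
  \esum_(z in setT) f z = \esum_(x in setT) \esum_(y in setT) f (x, y).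
Proof.
move=> f0; rewrite esum_esum// (_ : setT `*`` _ = setT); last by apply/seteqP; split.
by apply: eq_esum => -[].
Qed.

Lemma esum_exchange (T1 T2 : choiceType) (A : set T1) (B : set T2)
    (f : T1 -> T2 -> \bar R) : (forall x y, 0 <= f x y) ->
  \esum_(x in A) \esum_(y in B) f x y = \esum_(y in B) \esum_(x in A) f x y.
Proof.
move=> f0; rewrite !esum_esum//.
rewrite (reindex_esum (A `*`` (fun=> B)) (B `*`` (fun=> A)) (fun z => (z.2, z.1)))//.
split.
- by move=> [x y] [].
- by move=> [x y] [x' y'] _ _ [-> ->].
- by move=> [y x] [yB xA]; exists (x, y).
Qed.

Lemma esum_fibers (T1 T2 : choiceType) (h : T1 -> T2) (f : T2 -> T1 -> \bar R) :
  (forall a x, 0 <= f a x) ->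
  \esum_(a in setT) \esum_(x in [set x | h x = a]) f a x = \esum_(x in setT) f (h x) x.
Proof.
move=> f0; rewrite esum_esum//.
rewrite (reindex_esum setT _ (fun x => (h x, x)))//; split.
- by move=> x.
- by move=> x y _ _ [].
- by move=> [a x] [_ /= <-]; exists x.
Qed.

End esum_algebra.

(** * Integration against a coupling *)

Section couplings.
Variables (R : realType) (d : nat).
Local Notation T := 'rV[R]_d.
Variables (G G0 : dprob R d) (g : T * T -> R).
Hypothesis gG : coupling G G0 g.

Let g0 z : 0 <= g z. Proof. by case: gG. Qed.

Definition transport (h : T * T -> R) : \bar R := (\esum_(z in setT) (g z * h z)%:E)%E.

Lemma coupling_supp z : g z != 0 -> 0 < G z.1 /\ 0 < G0 z.2.
Proof.
case: gG z => _ gx gy [x y] /= gxy; have {}gxy : 0 < g (x, y).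
  by rewrite lt_neqAle eq_sym gxy g0.
split; rewrite -lte_fin.
- rewrite -gx; apply: (@lt_le_trans _ _ (g (x, y))%:E) => //.
  apply: le_trans (sum_le_esum (f := fun y => g (x, y)) (l := [:: y]) _ _ (subsetT _)) => //.
  by rewrite big_seq1.
- rewrite -gy; apply: (@lt_le_trans _ _ (g (x, y))%:E) => //.
  apply: le_trans (sum_le_esum (f := fun x => g (x, y)) (l := [:: x]) _ _ (subsetT _)) => //.
  by rewrite big_seq1.
Qed.

Lemma le_transport h1 h2 :
  (forall z, 0 < G z.1 -> 0 < G0 z.2 -> h1 z <= h2 z) -> (transport h1 <= transport h2)%E.
Proof.
move=> h12; apply: le_esum => z _; rewrite lee_fin.
have [->|/coupling_supp[Gz G0z]] := eqVneq (g z) 0; first by rewrite !mul0r.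
by rewrite ler_wpM2l// h12.
Qed.

Lemma transportD h1 h2 : (forall z, 0 <= h1 z) -> (forall z, 0 <= h2 z) ->
  transport (fun z => h1 z + h2 z) = (transport h1 + transport h2)%E.
Proof.
move=> h10 h20; rewrite /transport -esumD => [|z _|z _]; last 2 first.
- by rewrite lee_fin mulr_ge0.
- by rewrite lee_fin mulr_ge0.
by apply: eq_esum => z _; rewrite mulrDr EFinD.
Qed.

Lemma transportZ (c : R) h : 0 <= c -> (forall z, 0 <= h z) ->
  transport (fun z => c * h z) = (c%:E * transport h)%E.
Proof.
move=> c0 h0; rewrite /transport -esumZl//; last first.
  by move=> z; rewrite lee_fin mulr_ge0.
by apply: eq_esum => z _; rewrite mulrCA EFinM.
Qed.

Lemma transport_fst (C : set T) :
  transport (fun z => (z.1 \in C)%:R) = (set_mass G C)%:E.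
Proof.
have [_ gx _] := gG; rewrite set_massE esum_mkcond /transport esum_pair; last first.
  by move=> z; rewrite lee_fin mulr_ge0.
apply: eq_esum => x _ /=; case: ifP => xC; last first.
  by rewrite esum1// => y _; rewrite mulr0.
by rewrite -gx; apply: eq_esum => y _; rewrite mulr1.
Qed.

Lemma transport_snd (C : set T) :
  transport (fun z => (z.2 \in C)%:R) = (set_mass G0 C)%:E.
Proof.
have [_ _ gy] := gG; rewrite set_massE esum_mkcond /transport esum_pair; last first.
  by move=> z; rewrite lee_fin mulr_ge0.
rewrite esum_exchange; last by move=> x y; rewrite lee_fin mulr_ge0.
apply: eq_esum => y _ /=; case: ifP => yC; last first.
  by rewrite esum1// => x _; rewrite mulr0.
by rewrite -gy; apply: eq_esum => x _; rewrite mulr1.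
Qed.

Lemma transport1 : transport (fun=> 1) = 1%E.
Proof.
have := transport_fst setT; rewrite set_massT => <-.
by congr transport; apply/funext => z; rewrite in_setT.
Qed.

(* Moving the first marginal along [h] moves the coupling along with it. *)
Lemma wass_pushforward (r : R) (h : T -> T) (p : T -> R) :
  0 < r -> (forall a, p a = set_mass G [set x | h x = a]) ->
  (wass r p G0 <= poweR (transport (fun z => powR (enorm (h z.1 - z.2)) r)) r^-1)%E.
Proof.
move=> r0 ph; have [_ gx gy] := gG.
(* The image of [g] when [h] acts on the first coordinate. The inner sum is at most [G0 z.2], so
   [fine] loses nothing. *)
pose g' (z : T * T) : R := fine (\esum_(x in [set x | h x = z.1]) (g (x, z.2))%:E)%E.
have g'E z : ((g' z)%:E = \esum_(x in [set x | h x = z.1]) (g (x, z.2))%:E)%E.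
  rewrite fineK// ge0_fin_numE; last by apply: esum_ge0 => x _; rewrite lee_fin.
  apply: (@le_lt_trans _ _ (G0 z.2)%:E); last by rewrite ltry.
  rewrite -gy [leRHS](esumID [set x | h x = z.1]); last by move=> x _; rewrite lee_fin.
  by rewrite setTI leeDl// esum_ge0// => x _; rewrite lee_fin.
have cg' : coupling p G0 g'.
  split.
  - by move=> z; rewrite -lee_fin g'E esum_ge0// => x _; rewrite lee_fin.
  - move=> a; under eq_esum do rewrite g'E /=.
    rewrite esum_exchange; last by move=> *; rewrite lee_fin.
    by rewrite ph set_massE; apply: eq_esum => x _; rewrite gx.
  - move=> y; under eq_esum do rewrite g'E /=.
    rewrite (esum_fibers h (f := fun _ x => (g (x, y))%:E))//.
    by move=> *; rewrite lee_fin.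
rewrite /wass; apply: gt0_ler_poweR.
- by rewrite invr_ge0 ltW.
- rewrite in_itv /= leey andbT; apply: le_ereal_inf_tmp => _ [k [k0 _ _] <-].
  by apply: esum_ge0 => z _; rewrite lee_fin mulr_ge0// powR_ge0.
- rewrite in_itv /= leey andbT; apply: esum_ge0 => z _.
  by rewrite lee_fin mulr_ge0// powR_ge0.
apply: ereal_inf_lbound; exists g'; first exact: cg'.
have g'0 z : 0 <= g' z by case: cg'.
move: g' g'E cg' g'0 => g' g'E _ g'0.
pose c (z : T * T) := powR (enorm (z.1 - z.2)) r.
have c0 z : 0 <= c z by exact: powR_ge0.
have swap (f : T * T -> R) : (forall z, 0 <= f z) ->
    (\esum_(z in setT) (f z)%:E = \esum_(y in setT) \esum_(x in setT) (f (x, y))%:E)%E.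
  move=> f0; rewrite esum_pair; last by move=> z; rewrite lee_fin.
  by apply: esum_exchange => x y; rewrite lee_fin.
rewrite (swap (fun z => g' z * c z)); last by move=> z; rewrite mulr_ge0.
rewrite /transport (swap (fun z => g z * c (h z.1, z.2))); last first.
  by move=> z; rewrite mulr_ge0.
apply: eq_esum => y _.
rewrite [RHS](_ : _ = \esum_(a in setT) \esum_(x in [set x | h x = a]) (g (x, y) * c (a, y))%:E); last first.
  rewrite (esum_fibers h (f := fun a x => (g (x, y) * c (a, y))%:E))// => a x.
  by rewrite lee_fin mulr_ge0.
apply: eq_esum => a _; rewrite mulrC EFinM g'E -esumZl//.
  by apply: eq_esum => x _; rewrite -EFinM mulrC.
by move=> x; rewrite lee_fin.
Qed.

End couplings.

(** No optimal coupling is used: the infimum of the costs lies strictly below [powR (2 * e) r], so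
    some coupling does too. This is the origin of the factors 2 below. *)
Lemma wass_coupling (R : realType) (d : nat) (r e : R) (G G0 : dprob R d) :
  0 < r -> 0 < e -> (wass r G G0 <= e%:E)%E -> exists2 g, coupling G G0 g &
  (transport g (fun z => powR (enorm (z.1 - z.2)) r) <= (powR (2 * e) r)%:E)%E.
Proof.
move=> r0 e0; rewrite /wass; set S := [set _ | _ in _] => Se.
have S0 : (0 <= ereal_inf S)%E.
  apply: le_ereal_inf_tmp => _ [k [k0 _ _] <-].
  by apply: esum_ge0 => z _; rewrite lee_fin mulr_ge0// powR_ge0.
have : (ereal_inf S < (powR (2 * e) r)%:E)%E.
  rewrite ltNge; apply/negP => h.
  have ri : 0 <= r^-1 by rewrite invr_ge0 ltW.
  have := @gt0_ler_poweR R r^-1 ri (powR (2 * e) r)%:E (ereal_inf S).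
  rewrite !in_itv /= !leey !andbT S0 lee_fin powR_ge0 => /(_ isT isT h).
  rewrite -powRrM divff ?gt_eqF// powRr1 ?mulr_ge0 ?(ltW e0)//.
  by move=> /le_trans/(_ Se); rewrite lee_fin; lra.
by move=> /ereal_inf_lt[_ [g cg <-] gS]; exists g => //; exact: ltW.
Qed.

Section set_mass_lemmas.
Variables (R : realType) (d : nat) (G : dprob R d).
Local Notation T := 'rV[R]_d.

Lemma eq_set_mass (C1 C2 : set T) : (forall x, 0 < G x -> C1 x <-> C2 x) ->
  set_mass G C1 = set_mass G C2.
Proof.
move=> C12; apply: EFin_inj; rewrite !set_massE esum_mkcond [RHS]esum_mkcond.
apply: eq_esum => x _; have [Gx|] := ltP 0 (G x).
  have /propext Cx := C12 x Gx.
  by rewrite (_ : (x \in C1) = (x \in C2))//; apply/idP/idP; rewrite !inE Cx.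
move=> Gx; have -> : G x = 0 by apply/eqP; rewrite eq_le Gx mass_ge0.
by case: ifP; case: ifP.
Qed.

Lemma set_mass_gt0 (C : set T) : 0 < set_mass G C -> exists2 x, C x & 0 < G x.
Proof.
move=> C0; apply: contrapT => h.
have := @eq_set_mass C set0 _; rewrite /set_mass esum_set0 => C0'.
move: C0; rewrite /set_mass C0' ?ltxx// => x Gx; split=> // Cx.
by apply: h; exists x.
Qed.

Lemma sum_set_mass_fibers (f : T -> T) (K : seq T) (P : pred T) : uniq K ->
  \sum_(y <- K | P y) set_mass G [set u | f u = y] =
  set_mass G [set u | f u \in K /\ P (f u)].
Proof.
elim: K => [_|y K ih] /=.
  rewrite big_nil (_ : [set u | _] = set0) ?/set_mass ?esum_set0//.
  by apply/seteqP; split=> u // [].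
move=> /andP[yK uK]; rewrite big_cons ih//; case: ifPn => [Py|/negP Py].
  rewrite -set_massD; last first.
    by apply/seteqP; split=> u // [/= -> []]; rewrite (negbTE yK).
  apply: eq_set_mass => u _ /=; rewrite inE; split.
    by move=> [->|[-> ?]]; rewrite ?eqxx ?orbT.
  by move=> [/predU1P[->|]]; [left|right].
apply: eq_set_mass => u _ /=; rewrite inE; split=> [[-> ?]|]; first by rewrite orbT.
by move=> [/predU1P[->|]].
Qed.

End set_mass_lemmas.

(** * The algorithm near the true mixing measure *)

Section contraction.
Variables (R : realType) (d : nat).
Local Notation T := 'rV[R]_d.
Variables (Theta : set T) (G0 : dprob R d) (th : seq T) (r c w eta e sep pm : R).

(** The condition [eta <= 1 / 2] imposed below gives each neighbourhood diameter at most [w], so its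
    points merge in stage 1. *)
Definition atom_nbhd (b : T) : set T := eball b (eta * w).
Definition stray : set T := [set x | forall b, b \in th -> ~ atom_nbhd b x].

Lemma borel_stray : borel stray.
Proof.
have -> : stray = ~` \big[setU/set0]_(b <- th) atom_nbhd b.
  rewrite -bigcup_seq setC_bigcup; apply/seteqP; split=> x h b; exact: h.
apply: borelC; apply: (@bigsetU_measurable _ (g_sigma_algebraType [set U : set T | open U])).
move=> b _; apply: borel_open; exact: open_eball.
Qed.

Lemma atom_nbhd_stray b : b \in th -> atom_nbhd b `&` stray = set0.
Proof. by move=> bth; apply/seteqP; split=> x // [gx /(_ b bth)]. Qed.

Hypothesis r1 : 1 <= r.
Hypothesis w0 : 0 < w.
Hypothesis eta0 : 0 < eta.
Hypothesis e0 : 0 < e.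
Hypothesis thP : forall x, 0 < G0 x -> x \in th.
Variable G : dprob R d.
Hypothesis WG : (wass r G G0 <= (e * w)%:E)%E.

(** The dilation factor at a stray point [x]. For any atom [b], [w] is at most [1 / eta] times the
    distance from [x] to [b]. In units of that distance, stage 1 leads to a point within
    [1 / eta + 1] of [b], and stage 2 moves that point by at most [1 / eta + 2]. *)
Let C := 2 / eta + 3.

Let ew0 : 0 < eta * w. Proof. exact: mulr_gt0. Qed.
Let r0 : 0 < r. Proof. exact: lt_le_trans r1. Qed.
Let C0 : 0 <= C. Proof. by rewrite addr_ge0// divr_ge0// ltW. Qed.

Let kappa := powR (2 * (e * w)) r.

Definition stray_bound := powR (2 * e / eta) r.

Let cost (z : T * T) := powR (enorm (z.1 - z.2)) r.

Let couplingW : exists2 g, coupling G G0 g & (transport g cost <= kappa%:E)%E.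
Proof. by apply: wass_coupling => //; exact: mulr_gt0. Qed.

Let kappaE : kappa = stray_bound * powR (eta * w) r.
Proof.
rewrite /kappa /stray_bound -powRM ?divr_ge0 ?mulr_ge0 ?ltW//.
by congr powR; rewrite mulrA [RHS]mulrA divfK ?gt_eqF// mulrA.
Qed.

Let powew : 0 < powR (eta * w) r. Proof. exact: powR_gt0. Qed.

(** Markov's inequality: each unit of stray mass costs at least [powR (eta * w) r] to transport. *)
Lemma mass_stray_le : set_mass G stray <= stray_bound.
Proof.
have [g cg gk] := couplingW.
rewrite -(ler_pM2r powew) -kappaE -lee_fin mulrC EFinM -(transport_fst cg).
rewrite -(transportZ cg) ?(ltW powew)//.
apply: le_trans gk; apply: (le_transport cg) => z _ /thP z2; rewrite /cost.
have [zbad|_] := boolP (z.1 \in stray); last by rewrite mulr0 powR_ge0.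
rewrite mulr1; apply: ge0_ler_powR; rewrite ?nnegrE ?enorm_ge0 ?(ltW ew0) ?(ltW r0)//.
by move: zbad; rewrite inE => /(_ _ z2) /negP; rewrite -leNgt.
Qed.

(** Mass sent to [b] from outside its neighbourhood also pays at least [powR (eta * w) r] per unit,
    hence amounts to at most [stray_bound]. *)
Lemma mass_atom_nbhd_ge b : G0 b - stray_bound <= set_mass G (atom_nbhd b).
Proof.
have [g cg gk] := couplingW.
have h : (transport g (fun z => (z.2 \in [set b])%:R) <= transport g
    (fun z => (z.1 \in atom_nbhd b)%:R + (powR (eta * w) r)^-1 * cost z)%R)%E.
  apply: (le_transport cg) => z _ _; rewrite /cost.
  have ci : 0 <= (powR (eta * w) r)^-1 * cost z.
    by rewrite mulr_ge0 ?invr_ge0 ?powR_ge0.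
  have [|_] := boolP (z.2 \in _); last by rewrite addr_ge0 ?ler0n.
  rewrite inE /= => zb; have [_|zg] := boolP (z.1 \in atom_nbhd b); first by rewrite lerDl.
  rewrite add0r mulrC ler_pdivlMr// mul1r.
  apply: ge0_ler_powR; rewrite ?nnegrE ?enorm_ge0 ?(ltW ew0) ?(ltW r0)//.
  by move: zg; rewrite notin_setE zb => /negP; rewrite -leNgt.
move: h; rewrite (transport_snd cg) (transportD cg); last 2 first.
- by move=> z; rewrite ler0n.
- by move=> z; rewrite mulr_ge0 ?invr_ge0 ?powR_ge0.
rewrite (transport_fst cg) (transportZ cg) ?invr_ge0 ?powR_ge0//; last first.
  by move=> z; exact: powR_ge0.
move=> h; rewrite lerBlDr -lee_fin.
have -> : G0 b = set_mass G0 [set b].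
  by rewrite -[LHS](big_seq1 +%R b G0) -set_mass_seq//; congr set_mass;
    apply/seteqP; split=> x /=; rewrite inE => /eqP.
apply: le_trans h _; rewrite EFinD leeD2l//.
rewrite -(mulKf (lt0r_neq0 powew) stray_bound) EFinM lee_wpmul2l ?lee_fin ?invr_ge0 ?powR_ge0//.
by rewrite mulrC -kappaE.
Qed.

Hypothesis cT : compact Theta.
Hypothesis GT : gbar Theta G.
Hypothesis uth : uniq th.
Hypothesis th0 : th != [::].
Hypothesis c0 : 0 < c.
Hypothesis eta2 : eta <= 1 / 2.
Hypothesis sepP : forall a b, a \in th -> b \in th -> a != b -> sep <= enorm (a - b).
Hypothesis pmP : forall b, b \in th -> pm <= G0 b.
Hypothesis beta_pm : stray_bound <= pm / 4.
Hypothesis Ce_c : C * (2 * e) <= c.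
Hypothesis w_sep : 4 * w <= sep.
Hypothesis thr_pm : powR (c * w) r < pm / 2.
Hypothesis thr_sep : powR (c * w) r < pm / 2 * powR (sep / 2) r.
Variable t : nat -> option T.
Hypothesis tG : exhaustive_draws G t.
(** The condition on the order that fails with small probability: no stray draw comes before the
    first draw near [b]. *)
Hypothesis t_no_early_stray : forall b j, b \in th ->
  (forall i x, (i < j)%N -> t i = Some x -> ~ (atom_nbhd b `|` stray) x) ->
  forall x, t j = Some x -> ~ stray x.

Let ew2 : eta * w <= w / 2.
Proof. by move: eta2 w0; nra. Qed.

Let beta0 : 0 <= stray_bound. Proof. exact: powR_ge0. Qed.

Let pm0 : 0 < pm.
Proof. by have := le_lt_trans (powR_ge0 _ _) thr_pm; lra. Qed.

Let nbhds_apart a b x y : a \in th -> b \in th -> a != b -> atom_nbhd a x -> atom_nbhd b y ->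
  sep - w <= enorm (x - y) /\ w < enorm (x - y).
Proof.
move=> ath bth ab; rewrite /atom_nbhd /eball /= => xa yb; have := sepP ath bth ab.
have := ler_enorm_dist a x y; have := ler_enorm_dist a y b.
rewrite (enormB a x); move: ew2 w_sep w0 xa yb; lra.
Qed.

Let nbhd_near_key b x y : atom_nbhd b x -> atom_nbhd b y -> near_key w y x.
Proof.
rewrite /atom_nbhd /eball /near_key /= => xb yb; have := ler_enorm_dist x b y.
rewrite (enormB b y); move: ew2 xb yb; lra.
Qed.

Let not_stray x : ~ stray x -> exists2 b, b \in th & atom_nbhd b x.
Proof.
move=> nb; apply: contrapT => h; apply: nb => b bth gb; apply: h; exists b => //.
Qed.

Let far_stray x b : stray x -> b \in th -> eta * w <= enorm (x - b).
Proof. by move=> bx /bx; rewrite /atom_nbhd /eball /= => /negP; rewrite -leNgt. Qed.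

(* The first draw near [b] comes before any stray draw, so it stays in the list
   and collects the whole neighbourhood of [b]. *)
Let first_draw_near_atom b : b \in th -> exists j a, [/\ t j = Some a, atom_nbhd b a &
  forall i x, (i < j)%N -> t i = Some x -> exists2 b', b' \in th & b' != b /\ atom_nbhd b' x].
Proof.
move=> bth; have : 0 < set_mass G (atom_nbhd b).
  by have := mass_atom_nbhd_ge b; have := pmP bth; move: beta_pm pm0; lra.
move=> /set_mass_gt0[a0 ga0 /(mass_drawn tG)[j0 ja0]].
have [|j /asboolP[a [ja gba]] jmin] :=
    @ex_minnP (fun j => `[< exists a, t j = Some a /\ (atom_nbhd b `|` stray) a >]).
  by exists j0; apply/asboolP; exists a0; split=> //; left.
have before i x : (i < j)%N -> t i = Some x -> ~ (atom_nbhd b `|` stray) x.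
  move=> ij ix gbx; have := jmin i; rewrite leqNgt ij => /(_ _)/negP; apply => //.
  by apply/asboolP; exists x.
exists j, a; split=> //; first by case: gba => // /(t_no_early_stray bth before ja).
move=> i x ij ix; have nx := before i x ij ix.
have [|b' b'th gx] := @not_stray x; first by move=> bx; apply: nx; right.
exists b' => //; split=> //; apply/eqP => bb'; apply: nx; left; by rewrite -bb'.
Qed.

Let q (K : seq T) x := set_mass G [set y | center w K y = x].

Lemma mtm_contraction :
  size (mtm r c w G t) = size th /\
  forall delta, 0 < delta -> eta <= delta / 2 -> C * (2 * e) <= delta / 2 ->
    (wass r (list_mass (mtm r c w G t)) G0 <= (delta * w)%:E)%E.
Proof.
have [K [sK mE nK Kfirst]] := mergedP w0 cT GT tG.
have uK := separated_uniq w0 sK.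
(* [f b] is the first draw near [b]. Keys ahead of it lie near other atoms, more than [w] from all
   points near [b], so they absorb none of these. *)
have /choice[f fP] : forall b, exists a, b \in th ->
    [/\ atom_nbhd b a, a \in K & forall y, atom_nbhd b y -> center w K y = a].
  move=> b; have [bth|] := boolP (b \in th); last by exists 0.
  have [j [a [ja ga before]]] := first_draw_near_atom bth; exists a => _.
  have [|K1 [K2 [KE K1P]]] := Kfirst j a ja.
    move=> i x ij ix; have [b' b'th [b'b gx]] := before i x ij ix.
    by rewrite /near_key -ltNge; case: (nbhds_apart b'th bth b'b gx ga).
  split=> //; first by rewrite KE mem_cat mem_head orbT.
  move=> y gy; rewrite KE; apply: center_cat; last exact: nbhd_near_key gy.
  apply/hasPn => x /K1P[i ij ix]; have [b' b'th [b'b gx]] := before i x ij ix.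
  by rewrite /near_key -ltNge; case: (nbhds_apart b'th bth b'b gx gy).
pose cs := [seq f b | b <- th].
have fg b : b \in th -> atom_nbhd b (f b) by move=> /fP[].
have fK b : b \in th -> f b \in K by move=> /fP[].
have fc b y : b \in th -> atom_nbhd b y -> center w K y = f b by move=> /fP[_ _]; apply.
have csP a : a \in cs -> exists2 b, b \in th & a = f b by move=> /mapP.
have fcs b : b \in th -> f b \in cs by move=> bth; apply/mapP; exists b.
have csK : {subset cs <= K} by move=> _ /csP[b bth ->]; exact: fK.
have f_apart a b : a \in th -> b \in th -> a != b -> sep - w <= enorm (f a - f b).
  by move=> ath bth ab; case: (nbhds_apart ath bth ab (fg a ath) (fg b bth)).
have ucs : uniq cs.
  rewrite map_inj_in_uniq// => a b ath bth fab; apply/eqP/negPn/negP => ab.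
  have := f_apart a b ath bth ab; rewrite fab subrr enorm0.
  by move: w_sep w0; lra.
have cs0 : cs != [::] by rewrite -size_eq0 size_map size_eq0.
have q_heavy b : b \in th -> pm - stray_bound <= q K (f b).
  move=> bth; apply: (@le_trans _ _ (G0 b - stray_bound)); first by rewrite lerD2r pmP.
  apply: le_trans (mass_atom_nbhd_ge b) _; apply: le_set_mass => y; exact: fc.
have cell x y : x \in K -> x \notin cs -> center w K y = x -> stray y /\ enorm (x - y) <= w.
  move=> xK xcs yx; split.
    by move=> b bth /(fc b y bth) yb; move: xcs; rewrite -yx yb fcs.
  have [h|h] := boolP (has (near_key w y) K); first by rewrite -yx center_near.
  by move: yx; rewrite /center hasNfind// nth_default// => ->; rewrite subrr enorm0 ltW.
have q_light x : x \in K -> x \notin cs -> q K x <= stray_bound.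
  move=> xK xcs; apply: le_trans mass_stray_le; apply: le_set_mass => y yx.
  by case: (cell x y xK xcs yx).
(* The distance is at most [w], plus that from [y] to [b], plus [eta * w]; as [y] is stray, the
   first term is at most [1 / eta] times the second, and the last at most the second. *)
have stray_dist x y b : stray y -> b \in th -> enorm (x - y) <= w ->
    enorm (x - f b) <= (1 / eta + 2) * enorm (y - b).
  move=> yb bth xy; have := far_stray yb bth.
  have := ler_enorm_dist x y (f b); have := ler_enorm_dist y b (f b).
  have fb : enorm (b - f b) < eta * w by rewrite enormB; exact: fg.
  move=> h1 h2 yb'.
  have : w <= 1 / eta * enorm (y - b) by rewrite mul1r ler_pdivlMl// mulrC.
  by rewrite mulrDl; move: (1 / eta * _) => v; lra.
have kappaw : powR C r * kappa <= powR (c * w) r.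
  rewrite /kappa -powRM ?mulr_ge0 ?(ltW e0) ?(ltW w0)//.
  apply: ge0_ler_powR; rewrite ?nnegrE ?mulr_ge0 ?(ltW e0) ?(ltW w0) ?(ltW c0) ?(ltW r0)//.
  by rewrite !mulrA ler_wpM2r ?(ltW w0)// -mulrA.
have [g cg gk] := couplingW.
have q_close x : x \in K -> x \notin cs ->
    exists2 a, a \in cs & q K x * powR (enorm (x - a)) r <= powR (c * w) r.
  (* Take the nearest cluster key [a]. Wherever the coupling sends the cell of [x], the distance
     travelled is at least that from [x] to [a] divided by [C]. *)
  move=> xK xcs; have [a acs amin] := seq_argmin (fun a => enorm (x - a)) cs0.
  exists a => //; apply: le_trans kappaw; rewrite -lee_fin mulrC EFinM /q.
  rewrite -(transport_fst cg) -(transportZ cg) ?powR_ge0//.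
  apply: (@le_trans _ _ (transport g (fun z => powR C r * cost z))).
    apply: (le_transport cg) => z _ /thP z2; rewrite /cost -powRM ?enorm_ge0//.
    have [|_] := boolP (_ \in _); last by rewrite mulr0 powR_ge0.
    rewrite inE /= mulr1 => /(cell x _ xK xcs)[zb xz].
    apply: ge0_ler_powR; rewrite ?nnegrE ?mulr_ge0 ?enorm_ge0 ?(ltW r0)//.
    apply: le_trans (amin _ (fcs _ z2)) _; apply: le_trans (stray_dist x _ _ zb z2 xz) _.
    rewrite ler_wpM2r ?enorm_ge0// /C -[2 / eta]mulrC -[1 / eta]mulrC.
    by have : 0 < eta^-1 by [rewrite invr_gt0]; lra.
  rewrite (transportZ cg) ?powR_ge0//; last by move=> z; exact: powR_ge0.
  by rewrite EFinM lee_wpmul2l// lee_fin powR_ge0.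
(* With [stray_bound] at most [pm / 4], light keys weigh at most [pm / 4] and cluster keys at least
   [3 pm / 4]. *)
have heavy a x : a \in cs -> x \in K -> x \notin cs -> q K x < q K a.
  move=> /csP[b bth ->] xK xcs; have := q_heavy b bth; have := q_light x xK xcs.
  by move: beta_pm pm0; lra.
have thr_cs a : a \in cs -> powR (c * w) r < q K a.
  move=> /csP[b bth ->]; have := q_heavy b bth; move: beta_pm thr_pm pm0; lra.
have apart a b : a \in cs -> b \in cs -> a != b ->
    powR (c * w) r < q K a * powR (enorm (a - b)) r.
  move=> /csP[a' ath ->] /csP[b' bth ->] fab; apply: lt_le_trans thr_sep _.
  have sep0 : 0 < sep by move: w_sep w0; lra.
  apply: ler_pM; rewrite ?powR_ge0 ?divr_ge0 ?(ltW pm0)//.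
    by have := q_heavy a' ath; move: beta_pm pm0; lra.
  apply: ge0_ler_powR; rewrite ?nnegrE ?divr_ge0 ?enorm_ge0 ?(ltW r0) ?(ltW sep0)//.
  have := f_apart a' b' ath bth; have [ab|_ /(_ isT)] := eqVneq a' b'.
    by move: fab; rewrite ab eqxx.
  by move: w_sep w0; lra.
have mtmE : mtm r c w G t = let L := sort (fun x y : T * R => y.2 <= x.2) [seq (x, q K x) | x <- K] in
    let B := truncated r (powR (c * w) r) L in final_merge B [seq x <- L | x \notin B].
  by rewrite /mtm /sorted_merged mE.
split.
  by rewrite mtmE (size_truncate_merge uK ucs csK heavy thr_cs apart q_close) size_map.
move=> delta delta0 eta_d Ce_d; pose rel := relocate K cs (q K).
pose h x := rel (center w K x).
have relP := relocateP (q K) csK cs0.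
apply: (@le_trans _ _ (poweR (transport g (fun z => powR (enorm (h z.1 - z.2)) r)) r^-1)).
  apply: (wass_pushforward cg) => // a; rewrite mtmE.
  rewrite (list_mass_truncate_merge uK csK heavy thr_cs apart q_close cs0).
  (* Every point of positive mass has a near key, so its center does belong to [K]. *)
  rewrite sum_set_mass_fibers//; apply: eq_set_mass => x Gx /=.
  by rewrite center_mem ?nK//; split=> [[_ /eqP]|/eqP].
have dw0 : 0 < delta * w by exact: mulr_gt0.
apply: (@le_trans _ _ (poweR (powR (delta * w) r)%:E r^-1)); last first.
  by rewrite poweR_EFin -powRrM divff ?gt_eqF// powRr1// ltW.
have tr0 : (0 <= transport g (fun z => powR (enorm (h z.1 - z.2)) r))%E.
  by apply: esum_ge0 => z _; rewrite lee_fin mulr_ge0 ?powR_ge0//; case: cg.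
apply: gt0_ler_poweR; rewrite ?invr_ge0 ?(ltW r0) ?in_itv /= ?leey ?andbT//.
  by rewrite lee_fin powR_ge0.
(* Adding both bounds avoids splitting the integral according to which of them applies. *)
apply: (@le_trans _ _ (transport g (fun z => powR (eta * w) r * 1 + powR C r * cost z))).
  apply: (le_transport cg) => z Gz /thP z2; rewrite mulr1 /cost -powRM ?enorm_ge0//.
  suff : enorm (h z.1 - z.2) <= eta * w \/ enorm (h z.1 - z.2) <= C * enorm (z.1 - z.2).
    move=> [hz|hz]; [apply: ler_wpDr|apply: ler_wpDl]; rewrite ?powR_ge0//;
    by apply: ge0_ler_powR; rewrite ?nnegrE ?mulr_ge0 ?enorm_ge0 ?(ltW r0) ?(ltW ew0) ?(ltW w0) ?(ltW eta0).
  move: z.1 z.2 Gz z2 => x b Gx bth; have etaV : 0 < eta^-1 by rewrite invr_gt0.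
  have xb0 := enorm_ge0 (x - b).
  have [xbad|/not_stray[b' b'th gx]] := pselect (stray x).
    right; have xb := far_stray xbad bth.
    have wxb : w <= eta^-1 * enorm (x - b) by rewrite ler_pdivlMl// mulrC.
    have yx := center_near (nK x Gx); rewrite /h /C.
    have etaxb : (2 / eta + 3) * enorm (x - b) =
        2 * (eta^-1 * enorm (x - b)) + 3 * enorm (x - b) by ring.
    rewrite {}etaxb; have ycs := center_mem (nK x Gx).
    move: (center w K x) yx ycs => y yx yK; have [ycs|ycs] := boolP (y \in cs).
      rewrite /rel /relocate ycs; have := ler_enorm_dist y x b.
      by move: (eta^-1 * _) wxb yx w0 xb0 => v; lra.
    have [_ /(_ ycs _ (fcs b bth)) rely] := relP y.
    have := stray_dist y x b xbad bth yx.
    rewrite mul1r mulrDl => fby.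
    have := ler_enorm_dist (rel y) y b; have := ler_enorm_dist y x b.
    rewrite (enormB (rel y) y); move: rely; rewrite -/(rel y).
    by move: (eta^-1 * _) wxb fby yx w0 xb0 => v; lra.
  have -> : h x = f b'.
    by rewrite /h (fc b' x b'th gx) /rel /relocate fcs.
  have := fg b' b'th; rewrite /atom_nbhd /eball /= => fb'.
  (* If the coupling sends [x] to another atom, the distance travelled exceeds [w] and so dominates
     the displacement inside the neighbourhood. *)
  have [<-|b'b] := eqVneq b' b; [left; exact: ltW | right].
  have [_] := nbhds_apart b'th bth b'b gx (eball_center b ew0).
  have := ler_enorm_dist (f b') b' b; have := ler_enorm_dist b' x b.
  move: gx; rewrite /atom_nbhd /eball /= (enormB x b') => gx h1 h2 wxb.
  have : 3 * enorm (x - b) <= C * enorm (x - b).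
    by rewrite ler_wpM2r// /C lerDr divr_ge0// ltW.
  by move: (C * _) ew2 gx h1 h2 wxb fb' => v; lra.
rewrite (transportD cg); last 2 first.
- by move=> z; rewrite mulr1 powR_ge0.
- by move=> z; rewrite mulr_ge0 ?powR_ge0.
rewrite (transportZ cg) ?powR_ge0// (transport1 cg) mule1.
rewrite (transportZ cg) ?powR_ge0//; last by move=> z; exact: powR_ge0.
apply: (@le_trans _ _ ((powR (eta * w) r)%:E + (powR C r * kappa)%:E)%E).
  by rewrite leeD2l// EFinM lee_wpmul2l// lee_fin powR_ge0.
rewrite -EFinD lee_fin /kappa -powRM ?mulr_ge0 ?(ltW e0) ?(ltW w0)//.
(* Here [1 <= r] enters: the [r]-th power of 1/2 is at most 1/2. *)
have half x : 0 <= x -> x <= delta / 2 * w -> powR x r <= powR (delta * w) r / 2.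
  move=> x0 xd; apply: (@le_trans _ _ (powR (delta * w * 2^-1) r)).
    apply: ge0_ler_powR; rewrite ?nnegrE ?mulr_ge0 ?(ltW dw0) ?(ltW r0) ?(ltW w0) ?(ltW delta0)//.
    by rewrite mulrAC.
  rewrite powRM ?(ltW dw0)// ler_wpM2l ?powR_ge0//.
  rewrite -[leRHS]powRr1//; apply: ger_powR => //.
  by rewrite invr_gt0 ltr0n invf_le1 ?ler1n.
rewrite [leRHS]splitr lerD//; apply: half; rewrite ?(ltW ew0)//.
- by rewrite ler_wpM2r// ltW.
- by rewrite !mulr_ge0// ltW.
- rewrite (_ : C * _ = C * (2 * e) * w); last by rewrite !mulrA.
  by rewrite ler_wpM2r// ltW.
Qed.

End contraction.

(** * Convergence in probability *)

Lemma seq_separation (R : realType) (d : nat) (l : seq 'rV[R]_d) :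
  exists2 sep : R, 0 < sep & forall a b, a \in l -> b \in l -> a != b ->
    sep <= enorm (a - b).
Proof.
have [->|l0] := eqVneq l [::]; first by exists 1.
have /choice[rho rhoP] : forall a, exists rho : R, 0 < rho /\
    forall x, x \in l -> x != a -> rho <= enorm (x - a).
  by move=> a; have [rho] := finite_isolated l a; exists rho.
have [a al amin] := seq_argmin rho l0; exists (rho a); first by case: (rhoP a).
move=> x y xl yl xy; apply: le_trans (amin y yl) _.
by have [_] := rhoP y; apply.
Qed.

Lemma powR_le_id (R : realType) (x r : R) : 1 <= r -> 0 <= x -> x <= 1 -> powR x r <= x.
Proof.
move=> r1 x0 x1; have [->|x_neq0] := eqVneq x 0.
  by rewrite powR0// gt_eqF// (lt_le_trans _ r1).
rewrite -[leRHS](powRr1 x0); apply: ger_powR => //.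
by rewrite lt_neqAle eq_sym x_neq0 x0.
Qed.

Lemma abse_inner_prob (R : realType) (dT : measure_display) (T : measurableType dT)
    (P : {measure set T -> \bar R}) (A : set T) : P setT = 1%E ->
  (`|inner_prob P A - 1| = mu_ext P (~` A))%E.
Proof.
move=> PT; rewrite /inner_prob; have : (mu_ext P (~` A) <= 1)%E.
  by rewrite -PT -measurable_mu_extE//; apply: le_mu_ext.
have : (0 <= mu_ext P (~` A))%E by exact: mu_ext_ge0.
case: (mu_ext P (~` A)) => [u| |]//; rewrite !lee_fin => u0 u1.
have -> : (`|1 - u%:E - 1| = `|1 - u - 1|%R%:E)%E by [].
by rewrite addrAC subrr add0r normrN ger0_norm.
Qed.

(** Half of the tolerance is reserved for the random order; a failure above [e] thus forces a
    posterior failure above [e / 2]. *)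
Lemma cvg1_in_prob_transfer (R : realType) (dW : measure_display)
    (W : measurableType dW) (P : probability W R) (Y : nat -> W -> \bar R)
    (Y' : R -> nat -> W -> \bar R) :
  (forall e, 0 < e -> exists2 s, 0 < s & \forall n \near \oo, forall w,
     (e%:E < `|Y n w - 1|)%E -> ((e / 2)%:E < `|Y' s n w - 1|)%E) ->
  (forall s, 0 < s -> cvg1_in_prob P (Y' s)) -> cvg1_in_prob P Y.
Proof.
move=> YY' cY' e e0; have [s s0 near_le] := YY' e e0.
have e2 : 0 < e / 2 by rewrite divr_gt0.
apply: (squeeze_cvge _ (cvg_cst 0%E) (cY' s s0 _ e2)).
apply: filterS near_le => n h; apply/andP; split; first exact: mu_ext_ge0.
by apply: le_mu_ext => w /h.
Qed.

Lemma near_lt_cvg0 (R : realType) (u : nat -> R) (b : R) :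
  u n @[n --> \oo] --> (0 : R) -> 0 < b -> \forall n \near \oo, u n < b.
Proof.
move=> /cvgrPdist_lt h b0; apply: filterS (h b b0) => n.
by rewrite sub0r normrN; apply: le_lt_trans; exact: ler_norm.
Qed.

(** * Choice of the contraction scale *)

Section parameters.
Variables (R : realType).

(* [s] is the multiple of [omega n] at which contraction is used: a smaller [s]
   makes the stray mass [(2 s / eta)^r] small. *)
Lemma contraction_scale (c delta eta r M : R) : 0 < c -> 0 < delta -> 0 < eta ->
  1 <= r -> 0 < M -> exists2 s, 0 < s &
  [/\ (2 / eta + 3) * (2 * s) <= c, (2 / eta + 3) * (2 * s) <= delta / 2 &
      powR (2 * s / eta) r <= M].
Proof.
move=> c0 d0 eta0 r1 M0; set C := 2 / eta + 3.
have C0 : 0 < C by rewrite addr_gt0// divr_gt0.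
(* Below 1 the [r]-th power is at most its argument, so a bound linear in [s] is enough. *)
pose m := Num.min 1 M; have m0 : 0 < m by rewrite lt_min ltr01 M0.
pose s := Num.min (Num.min (c / (C * 2)) (delta / 2 / (C * 2))) (m * eta / 2).
have C2 : 0 < C * 2 by rewrite mulr_gt0.
have s0 : 0 < s by rewrite !lt_min !divr_gt0 ?mulr_gt0.
have sc : s <= c / (C * 2) by rewrite !ge_min lexx.
have sd : s <= delta / 2 / (C * 2) by rewrite !ge_min lexx orbT.
have sm : s <= m * eta / 2 by rewrite ge_min lexx orbT.
exists s => //; split.
- by move: sc; rewrite ler_pdivlMr// => sc; rewrite mulrA mulrC.
- by move: sd; rewrite ler_pdivlMr// => sd; rewrite mulrA mulrC.
have se : 2 * s / eta <= m.
  by rewrite ler_pdivrMr//; move: sm; rewrite ler_pdivlMr// mulrC.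
apply: (@le_trans _ _ (2 * s / eta)); last first.
  by apply: le_trans se _; rewrite ge_min lexx orbT.
apply: powR_le_id => //; first by rewrite !mulr_ge0 ?invr_ge0 ?ltW.
by apply: le_trans se _; rewrite ge_min lexx.
Qed.

End parameters.

(** * The algorithm with a random order *)

Section random_merge.
Variables (R : realType) (d : nat) (Theta : set 'rV[R]_d) (G0 : dprob R d).
Variables (r c : R) (omega : nat -> R).
Hypothesis cT : compact Theta.
Hypothesis r1 : 1 <= r.
Hypothesis c0 : 0 < c.
Hypothesis omega_gt0 : forall n, 0 < omega n.
Hypothesis omega_cvg0 : omega n @[n --> \oo] --> (0 : R).
Variables (dE : measure_display) (E : measurableType dE) (nu : probability E R).
Variable order : dprob R d -> E -> nat -> option 'rV[R]_d.
Hypothesis orderP : samples_without_replacement nu order.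

(** A union bound over the atoms. The induction runs on [l] while the stray set, defined by the full
    list [th], stays fixed. *)
Lemma small_early_draws (th l : seq 'rV[R]_d) (w eta g b : R) :
  {subset l <= th} -> 0 < g -> 0 <= b -> exists Z : set (dprob R d * E),
  [/\ measurable Z, defective order `<=` Z,
      forall a, a \in l -> early_draw order g b (atom_nbhd w eta a) (stray th w eta) `<=` Z &
      forall G, (nu (xsection Z G) <= ((size l)%:R * (b / g))%:E)%E].
Proof.
move=> + g0 b0; elim: l => [_|a l ih alth].
  exists (defective order); split=> //; first exact: measurable_defective orderP.
  by move=> G; rewrite defective_null// mul0r.
have [|Z [mZ dZ lZ Zl]] := ih.
  by move=> x xl; apply: alth; rewrite inE xl orbT.
have ath : a \in th by apply: alth; exact: mem_head.
have ba : borel (atom_nbhd w eta a) by apply: borel_open; exact: open_eball.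
have bb := borel_stray th w eta.
have me := measurable_early_draw orderP g b ba bb.
exists (Z `|` early_draw order g b (atom_nbhd w eta a) (stray th w eta)); split.
- exact: measurableU.
- by apply: subset_trans dZ _; exact: subsetUl.
- move=> x; rewrite inE => /predU1P[->|xl]; first exact: subsetUr.
  by apply: subset_trans (lZ x xl) _; exact: subsetUl.
move=> G; have xE (A : set (dprob R d * E)) : xsection A G = [set u | A (G, u)].
  by apply/seteqP; split=> u; rewrite /xsection /= inE.
have -> : xsection (Z `|` early_draw order g b (atom_nbhd w eta a) (stray th w eta)) G =
    xsection Z G `|` xsection (early_draw order g b (atom_nbhd w eta a) (stray th w eta)) G.
  by rewrite !xE.
apply: le_trans (measureU2 _ _ _) _; try exact: measurable_xsection.
rewrite /= -[(size l).+1]addn1 natrD mulrDl mul1r EFinD leeD//.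
by apply: prob_early_draw => //; exact: atom_nbhd_stray.
Qed.

Lemma mtm_contraction_prob k0 (delta ee : R) : ([set x | 0%R < G0 x] #= `I_k0)%card ->
  0 < delta -> 0 < ee ->
  exists2 s, 0 < s & \forall n \near \oo,
    forall m1 : {measure set (dprob R d) -> \bar R}, m1 setT = 1%E ->
    (mu_ext (m1 \x nu) (~` [set z : dprob R d * E |
        size (mtm r c (omega n) z.1 (order z.1 z.2)) = k0 /\ gbar Theta z.1 /\
        (wass r (list_mass (mtm r c (omega n) z.1 (order z.1 z.2))) G0
          <= (delta * omega n)%:E)%E]) <=
     mu_ext m1 (~` [set G | gbar Theta G /\ (wass r G G0 <= (s * omega n)%:E)%E]) + ee%:E)%E.
Proof.
move=> hk0 delta0 ee0; pose A := [set x | 0 < G0 x].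
have finA : finite_set A by exists k0.
pose th : seq 'rV[R]_d := finmap.enum_fset (fset_set A).
have uth : uniq th by exact: finmap.fset_uniq.
have sth : size th = k0 := card_fset_set hk0.
have thE x : (x \in th) = (0 < G0 x) by rewrite /th in_fset_set// mem_setE.
have thP x : 0 < G0 x -> x \in th by rewrite thE.
have th0 : th != [::].
  apply/eqP => th0; have := mass_sum1 G0; rewrite esum1.
    by move=> /eqP; rewrite eq_sym onee_eq0.
  move=> x _; congr EFin; apply/eqP; rewrite eq_le mass_ge0 andbT leNgt.
  by rewrite -thE th0.
have [b0 b0th pmP] := seq_argmin G0 th0; set pm := G0 b0 in pmP.
have pm0 : 0 < pm by rewrite /pm -thE.
have [sep sep0 sepP] := seq_separation th.
pose eta := Num.min (1 / 2) (delta / 2).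
have eta0 : 0 < eta by rewrite lt_min !divr_gt0.
have eta2 : eta <= 1 / 2 by rewrite ge_min lexx.
have etad : eta <= delta / 2 by rewrite ge_min lexx orbT.
have k0R : 0 < k0%:R :> R by rewrite ltr0n -sth lt0n size_eq0.
(* The first bound separates heavy keys from light ones. The second makes the union bound over [k0]
   atoms at most [ee], each neighbourhood having mass at least [pm / 2]. *)
pose M := Num.min (pm / 4) (ee * (pm / 2) / k0%:R).
have M0 : 0 < M by rewrite lt_min !divr_gt0 ?mulr_gt0 ?divr_gt0.
have [s s0 [sc sd sM]] := contraction_scale c0 delta0 eta0 r1 M0.
have bpm : stray_bound r eta s <= pm / 4 by apply: le_trans sM _; rewrite ge_min lexx.
have bee : k0%:R * (stray_bound r eta s / (pm / 2)) <= ee.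
  rewrite mulrA ler_pdivrMr ?divr_gt0// mulrC -ler_pdivlMr//.
  by apply: le_trans sM _; rewrite ge_min lexx orbT.
have beta0 : 0 <= stray_bound r eta s by exact: powR_ge0.
exists s => //; pose M2 := Num.min 1 (Num.min (pm / 2) (pm / 2 * powR (sep / 2) r)).
have M20 : 0 < M2.
  by rewrite !lt_min ltr01 divr_gt0//= mulr_gt0 ?divr_gt0// powR_gt0// divr_gt0.
have sep4 : 0 < sep / 4 by rewrite divr_gt0.
apply: filterS2 (near_lt_cvg0 omega_cvg0 sep4)
  (near_lt_cvg0 omega_cvg0 (divr_gt0 M20 c0)) => n nsep nM m1 m1T.
have w0 := omega_gt0 n; have cwM : c * omega n < M2.
  by move: nM; rewrite ltr_pdivlMr// mulrC.
have cw : powR (c * omega n) r < M2.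
  apply: (le_lt_trans _ cwM); apply: powR_le_id => //; first by rewrite mulr_ge0 ?ltW.
  by rewrite ltW// (lt_le_trans cwM)// ge_min lexx.
have w_sep : 4 * omega n <= sep.
  by move: nsep; rewrite ltr_pdivlMr// mulrC => /ltW.
have thr_pm : powR (c * omega n) r < pm / 2.
  by apply: lt_le_trans cw _; rewrite !ge_min lexx /= orbT.
have thr_sep : powR (c * omega n) r < pm / 2 * powR (sep / 2) r.
  by apply: lt_le_trans cw _; rewrite !ge_min lexx !orbT.
have pm2 : 0 < pm / 2 by rewrite divr_gt0.
have [Z [mZ dZ thZ Zee]] :=
  @small_early_draws th th (omega n) eta _ _ (fun _ => id) pm2 beta0.
apply: (mu_ext_product_le m1T mZ).
  by move=> G; apply: le_trans (Zee G) _; rewrite lee_fin sth.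
move=> [G u] /= nS; have [Zz|nZ] := pselect (Z (G, u)); [by right|left].
move=> [GT WG]; apply: nS.
have tG : exhaustive_draws G (order G u).
  by apply: (@defectiveP _ _ _ _ order (G, u)) => h; exact/nZ/dZ.
have t_no_early_stray b j : b \in th ->
    (forall i x, (i < j)%N -> order G u i = Some x ->
      ~ (atom_nbhd (omega n) eta b `|` stray th (omega n) eta) x) ->
    forall x, order G u j = Some x -> ~ stray th (omega n) eta x.
  (* A stray draw at time [j] ahead of the neighbourhood of [b] would put the pair in [early_draw],
     hence in [Z]. *)
  move=> bth h x jx xbad; apply: nZ; apply: (thZ b bth); split=> /=.
    split; last exact: (mass_stray_le r1 w0 eta0 s0 thP WG).
    have := mass_atom_nbhd_ge r1 w0 eta0 s0 WG b; have := pmP b bth.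
    by move: bpm pm0; lra.
  exists j => //; split; last by exists x.
  by move=> i ij [y gy iy]; exact: h ij iy gy.
have [sE wE] := mtm_contraction r1 w0 eta0 s0 thP WG cT GT uth th0 c0 eta2 sepP
  pmP bpm sc w_sep thr_pm thr_sep tG t_no_early_stray.
by rewrite sE sth; split=> //; split=> //; exact: wE.
Qed.

End random_merge.

Theorem theorem3p2 (R : realType) (d : nat) (Theta : set 'rV[R]_d)
  (hTheta : compact Theta)
  (dX : measure_display) (X : measurableType dX)
  (mu : {sigma_finite_measure set X -> \bar R})
  (f : X -> 'rV[R]_d -> R)
  (hf_meas : forall theta, Theta theta -> measurable_fun setT (f ^~ theta))
  (hf_ge0 : forall x theta, Theta theta -> 0 <= f x theta)
  (hf_int : forall theta, Theta theta -> (\int[mu]_x (f x theta)%:E = 1)%E)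
  (k0 : nat) (G0 : dprob R d) (hG0 : gbar Theta G0)
  (hk0 : ([set x | 0 < G0 x] #= `I_k0)%card)
  (dW : measure_display) (W : measurableType dW) (P : probability W R)
  (Xs : nat -> {mfun W >-> X})
  (hXs : iid_from_density P mu (mixture_density f G0) Xs)
  (r : R) (hr : 1 <= r)
  (omega : nat -> R) (homega_gt0 : forall n, 0 < omega n)
  (homega0 : omega n @[n --> \oo] --> (0 : R))
  (bayes : forall n, bayes_procedure Theta X n)
  (hcontract : forall delta : R, 0 < delta ->
    cvg1_in_prob P (fun n w =>
      inner_prob (bp_post (bayes n) [tuple Xs i w | i < n])
        [set G | gbar Theta G /\ (wass r G G0 <= (delta * omega n)%:E)%E]))
  (c : R) (hc : 0 < c)
  (dE : measure_display) (E : measurableType dE) (nu : probability E R)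
  (order : dprob R d -> E -> nat -> option 'rV[R]_d)
  (horder : samples_without_replacement nu order) :
  cvg1_in_prob P (fun n w =>
    inner_prob (bp_post (bayes n) [tuple Xs i w | i < n] \x nu)%E
      [set z : dprob R d * E | size (mtm r c (omega n) z.1 (order z.1 z.2)) = k0])
  /\
  (forall delta : R, 0 < delta ->
    cvg1_in_prob P (fun n w =>
      inner_prob (bp_post (bayes n) [tuple Xs i w | i < n] \x nu)%E
        [set z : dprob R d * E | gbar Theta z.1 /\
           (wass r (list_mass (mtm r c (omega n) z.1 (order z.1 z.2))) G0
              <= (delta * omega n)%:E)%E])).
Proof.
(* Both claims concern events containing the same good event, on which the size is [k0] and the
   output is close to [G0]. *)
have main delta (S : nat -> set (dprob R d * E)) : 0 < delta ->
    (forall n, [set z : dprob R d * E |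
        size (mtm r c (omega n) z.1 (order z.1 z.2)) = k0 /\ gbar Theta z.1 /\
        (wass r (list_mass (mtm r c (omega n) z.1 (order z.1 z.2))) G0
          <= (delta * omega n)%:E)%E] `<=` S n) ->
    cvg1_in_prob P (fun n w =>
      inner_prob (bp_post (bayes n) [tuple Xs i w | i < n] \x nu)%E (S n)).
  move=> delta0 SS; apply: cvg1_in_prob_transfer hcontract => e e0.
  have e2 : 0 < e / 2 by rewrite divr_gt0.
  have [s s0 near_le] := mtm_contraction_prob hTheta hr hc homega_gt0 homega0 horder
    hk0 delta0 e2.
  exists s => //; apply: filterS near_le => n h w.
  set m1 := bp_post (bayes n) _.
  have m1T : m1 setT = 1%E by exact: prob_kernel.
  have pT : (m1 \x nu)%E setT = 1%E.
    rewrite -setXTT; have -> := product_measure1E m1 nu measurableT measurableT.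
    by rewrite m1T mul1e; exact: probability_setT.
  rewrite !abse_inner_prob//; have {}h := h m1 m1T.
  have := le_trans (le_mu_ext (m1 \x nu)%E (subsetC (SS n))) h.
  move=> le1 /lt_le_trans/(_ le1).
  case: (mu_ext m1 _) => [y| |]; first by rewrite -EFinD !lte_fin; lra.
    by move=> _; exact: ltry.
  by [].
split=> [|delta delta0]; last by apply: (main delta) => // n z [].
(* The size does not involve [delta], so any positive value serves. *)
by apply: (main 1) => // n z [].
Qed.
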